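(* Let $(\mathscr{S},d)$ be a complete metric space, let $f\colon \mathscr{S}\to(-\infty,+\infty]$ be proper and lower semicontinuous, and let $u_0\in D(f)$. Suppose that $f$ is $(p_0,\lambda)$-convex for some $\lambda<0$ and $p_0\in[2,+\infty)$. Call a triple $(p,p',u)$ with $p,p'\in(1,p_0]$ and $u\in\mathrm{CMS}_p([0,+\infty);u_0)$ admissible if one of the following holds: (a) $S^\ast_{p\to p'}=+\infty$; (b) $S^\ast_{p\to p'}<+\infty$ and $T^\ast_u<+\infty$; (c) $S^\ast_{p\to p'}<+\infty$, $T^\ast_u=+\infty$ and the limit $\lim_{t\uparrow T^\ast_u}u(t)$ exists. Then to every admissible triple $(p,p',u)$ one can associate a non-decreasing continuous map $\bm{t}_{p\to p'}=\bm{t}_{p\to p',u}\colon[0,+\infty)\to[0,T^\ast_u]$ such that: (1) the curve $u_{p'}:=u\circ \bm{t}_{p\to p'}$ belongs to $\mathrm{CMS}_{p'}([0,+\infty);u_0)$; (2) if $v\in\mathrm{CMS}_p([0,+\infty);u_0)$ is equal to $u$, then $\bm{t}_{p\to p',u}=\bm{t}_{p\to p',v}$; (3) the triple $(p',p,u_{p'})$ is again admissible, and the map $\bm{t}_{p'\to p}=\bm{t}_{p'\to p,u_{p'}}$ associated with it satisfies the inverse transformation $u=u_{p'}\circ\bm{t}_{p'\to p}$.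
   Context: $D(f):=\{v\in\mathscr{S}: f(v)<+\infty\}$; proper means $D(f)\neq\emptyset$. $\mathscr{L}$ is Lebesgue measure. The local slope is $|\partial^- f|(v):=\limsup_{w\to v}\frac{(f(v)-f(w))^+}{d(v,w)}$ if $v\in D(f)$ and $+\infty$ otherwise, where $r^+=\max\{r,0\}$. For $a\in(0,+\infty]$, $AC_{loc}([0,a);\mathscr{S})$ is the set of curves $u\colon[0,a)\to\mathscr{S}$ for which there is $m\in L^1_{loc}([0,a))$ (integrable on compact subsets of $[0,a)$) with $d(u(s),u(t))\le\int_s^t m(r)\,dr$ for all $s\le t$ in $[0,a)$; for such $u$ the metric derivative $|u'|(t):=\lim_{s\to t}\frac{d(u(t),u(s))}{|t-s|}$ exists for $\mathscr{L}$-a.e. $t$. Let $p\in(1,+\infty)$ with conjugate exponent $q$ ($1/p+1/q=1$). A curve $u\in AC_{loc}([0,a);\mathscr{S})$ is a $p$-curve of maximal slope for $f$ starting from $u_0\in D(f)$ if $u(0)=u_0$, $f\circ u$ is non-increasing, and $(f\circ u)'(t)\le-\frac1p|u'|^p(t)-\frac1q|\partial^- f|^q(u(t))$ for $\mathscr{L}$-a.e. $t\in[0,a)$. $\mathrm{CMS}_p([0,a);u_0)$ denotes the set of all such curves defined on $[0,a)$. $f$ is $(p,\lambda)$-convex ($p\in(1,+\infty)$, $\lambda\in\mathbb{R}$) if there is $\psi\colon[0,1]\to[0,1]$ with $\lim_{t\downarrow0}\psi(t)=0$ and $\psi(t)<1$ for some $t\in(0,1)$, such that for any $v_0,v_1\in\mathscr{S}$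 there is a curve (continuous map) $\gamma\colon[0,1]\to\mathscr{S}$ from $v_0$ to $v_1$ with $d(\gamma_t,\gamma_0)\le t\,d(\gamma_1,\gamma_0)$ and $f(\gamma_t)\le(1-t)f(\gamma_0)+tf(\gamma_1)-\lambda t(1-\psi(t))d^p(\gamma_0,\gamma_1)$ for every $t\in[0,1]$. For $u\in\mathrm{CMS}_p([0,a);u_0)$, $T^\ast_u:=\sup\{t\in[0,a): |\partial^- f|(u(t))>0\}\in[0,+\infty]$ (with $\sup\emptyset=0$). For exponents $p,p'$ with conjugates $q,q'$ and $u\in\mathrm{CMS}_p([0,a);u_0)$, $S^\ast_{p\to p'}=S^\ast_{p\to p',u}:=\int_0^{T^\ast_u}|u'|^\alpha(r)\,dr\in[0,+\infty]$ with $\alpha:=1-\frac pq\cdot\frac{q'}{p'}$ (here $|u'|>0$ a.e. on $[0,T^\ast_u)$). The maps $\bm{t}_{p\to p'}$ may take the value $T^\ast_u=+\infty$; in that case $u(+\infty):=\lim_{t\to+\infty}u(t)$, and it is understood that this limit exists whenever the value $+\infty$ is attained. *)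

(* Defs.v *)
From HB Require Import structures.
From mathcomp Require Import all_boot all_order all_algebra.
From mathcomp Require Import all_classical all_reals all_analysis.
Set Implicit Arguments.
Unset Strict Implicit.
Unset Printing Implicit Defensive.
Import Order.TTheory GRing.Theory Num.Theory.
Import numFieldNormedType.Exports.
Local Open Scope classical_set_scope.
Local Open Scope ring_scope.

#[short(type="completeMetricType")]
HB.structure Definition CompleteMetric (K : numFieldType) :=
  {M of Complete M & Metric K M}.

Definition conj_exp {R : realType} (p : R) : R := (1 - p^-1)^-1.

Lemma conj_expP {R : realType} (p : R) : p^-1 + (conj_exp p)^-1 = 1.
Proof. by rewrite /conj_exp invrK addrC subrK. Qed.

(* The interval [0, a). Curves on it are total functions R -> S of which only
   the values on [0, a) matter. *)
Definition itv0 {R : realType} (a : \bar R) : set R :=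
  [set t | 0 <= t /\ (t%:E < a)%E].

Section functionals.
Context {R : realType} {S : completeMetricType R}.
Implicit Types (f : S -> \bar R) (a : \bar R) (u : R -> S) (p lambda : R).

Definition finite_domain f : set S := [set v | (f v < +oo)%E].

Definition proper_functional f : Prop := finite_domain f !=set0.

(* The limsup is over w -> v with w != v. [maxe 0] only matters at isolated
   points, where the limsup over the improper filter v^' is -oo and the slope
   is 0 by convention. *)
Definition local_slope f (v : S) : \bar R :=
  if (f v < +oo)%E then
    maxe 0%E
      (limf_esup (fun w => maxe (f v - f w) 0 * ((mdist v w)^-1)%:E)%E v^')
  else +oo%E.

Definition ACloc a u : Prop :=
  exists m : R -> R,
    (forall K : set R, compact K -> K `<=` itv0 a ->
       (@lebesgue_measure R).-integrable K (EFin \o m)) /\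
    (forall s t, itv0 a s -> itv0 a t -> s <= t ->
       ((mdist (u s) (u t))%:E <=
          \int[@lebesgue_measure R]_(r in `[s, t]) (m r)%:E)%E).

(* The dummy value taken where the limit does not exist is irrelevant: for
   u in ACloc it exists a.e. *)
Definition metric_derivative u (t : R) : R :=
  lim (mdist (u t) (u s) / `|t - s| @[s --> t^']).

(* Along such a curve f is finite when f u0 is, so [fine] only converts to R. *)
Definition CMS f p a (u0 : S) : set (R -> S) := [set u |
  [/\ ACloc a u,
      u 0 = u0,
      (forall s t, itv0 a s -> itv0 a t -> s <= t -> (f (u t) <= f (u s))%E) &
      {ae (@lebesgue_measure R), forall t : R, itv0 a t ->
         derivable (fine \o f \o u : R -> R) t 1 /\
         (((derive1 (fine \o f \o u : R -> R) t)%:E <=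
            - (p^-1 * metric_derivative u t `^ p)%:E
            - ((conj_exp p)^-1)%:E * (local_slope f (u t) `^ conj_exp p))%E)}]].

(* At t = 0 and t = 1 with an infinite value of f, 0 * +oo = 0. *)
Definition pl_convex f p lambda : Prop :=
  exists psi : R -> R,
    [/\ (forall t : R, 0 <= t <= 1 -> 0 <= psi t <= 1),
        psi t @[t --> 0^'+] --> (0 : R),
        (exists2 t : R, 0 < t < 1 & psi t < 1) &
        forall v0 v1 : S, exists gamma : R -> S,
          [/\ {within `[0, 1], continuous gamma},
              gamma 0 = v0,
              gamma 1 = v1 &
              forall t : R, 0 <= t <= 1 ->
                mdist (gamma t) v0 <= t * mdist v1 v0 /\
                (f (gamma t) <= (1 - t)%:E * f v0 + t%:E * f v1
                  - (lambda * t * (1 - psi t) *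
                       mdist v0 v1 `^ p)%:E)%E]].

(* [maxe 0] implements sup set0 = 0; all the t's are nonnegative. *)
Definition Tstar f a u : \bar R :=
  maxe 0%E
    (ereal_sup [set t%:E | t in [set t | itv0 a t /\
                                         (0 < local_slope f (u t))%E]]).

Definition alpha_exp p p' : R :=
  1 - p / conj_exp p * (conj_exp p' / p').

(* Note that 0 `^ r = 0 for r < 0; this is harmless since |u'| > 0 a.e. on the
   domain of integration. *)
Definition Sstar f a p p' u : \bar R :=
  let D := [set r : R | 0 <= r /\ (r%:E < Tstar f a u)%E] in
  (\int[@lebesgue_measure R]_(r in D)
     (metric_derivative u r `^ alpha_exp p p')%:E)%E.

(* u(t) for t in [0, +oo], with u(+oo) the limit of u at +oo, to be used only
   when this limit exists; the value at -oo is a dummy. *)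
Definition curve_at u (t : \bar R) : S :=
  match t with
  | r%:E => u r
  | +oo%E => lim (u r @[r --> +oo])
  | -oo%E => u 0
  end.

Definition admissible f p0 (u0 : S) p p' u : Prop :=
  [/\ 1 < p <= p0, 1 < p' <= p0, CMS f p +oo%E u0 u &
      [\/ Sstar f +oo%E p p' u = +oo%E,
          (Sstar f +oo%E p p' u < +oo)%E /\ (Tstar f +oo%E u < +oo)%E |
          [/\ (Sstar f +oo%E p p' u < +oo)%E, Tstar f +oo%E u = +oo%E &
              cvg (u t @[t --> +oo])]]].

End functionals.

(* Main.v *)
Require Import Defs.
From HB Require Import structures.
From mathcomp Require Import all_boot all_order all_algebra.
From mathcomp Require Import all_classical all_reals all_analysis.
From mathcomp Require Import measurable_realfun.
From mathcomp Require Import ring lra.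
Set Implicit Arguments.
Unset Strict Implicit.
Unset Printing Implicit Defensive.
Import Order.TTheory GRing.Theory Num.Theory.
Import numFieldNormedType.Exports.
Local Open Scope classical_set_scope.
Local Open Scope ring_scope.

(** Write [m] for the metric derivative |u'| of a [p]-curve of maximal slope.

    The inequality defining such a curve is in fact an equality. Convexity
    gives f v - f w <= |df|(v) d + |lambda| d^p0 with d = d(v, w)
    ([slope_upper]); as p0 >= 2 the last term is of second order along the
    curve, so - (f o u)' <= |df|(u) m almost everywhere. Against the defining
    inequality this is the equality case of Young's inequality
    ([young_equality]), hence (f o u)' = - m^p and |df|(u) = m^(p - 1) almost
    everywhere ([CMS_maximal_speed]). Conversely a curve satisfying these two
    identities, along which f decreases, is a curve of maximal slope
    ([maximal_speed_CMS]). Everything thus reduces to identities between powers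
    of [m], which behave well under changes of time: if time is changed so that
    the new speed at the old time t is m^k with k = (p - 1) / (p' - 1), then
    |df| = m^(p - 1) = (m^k)^(p' - 1). Since dividing m by a density w gives the
    new speed, w = m^(1 - k) = m^alpha, which explains the integral Sstar.

    For the time change to exist, m must be positive and m^alpha locally
    integrable up to Tstar. The slope is lower semicontinuous by convexity
    ([slope_lsc]), so positivity of the slope is an open condition; and a point
    of zero slope is never left, because moving by d in a short time h dissipates
    at least about d^p / h^(p - 1), whereas convexity makes at most
    |lambda| d^p0 available, and p <= p0 ([stationary_after]). Therefore the
    slope is positive exactly before Tstar ([slope_gt0_Tstar]), it is bounded below
    on compact subintervals by positive constants, and so is m almost
    everywhere, which settles the case alpha < 0 ([weight_integrable]).

    The map t_{p -> p'} is the inverse of F(t) = \int_0^t m^alpha, continued by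
    Tstar from time Sstar on ([time_map]). The image of Lebesgue measure under the
    inverse of F has density m^alpha ([ge0_integral_time_change]); so the new
    curve is absolutely continuous, and null sets of bad times of u correspond to
    null sets of bad new times, which transports the two identities
    ([changed_curve_maximal_speed]). After Sstar the new curve rests at u(Tstar), where
    the slope vanishes: otherwise f would decrease at a definite rate for ever
    ([end_point_slope]). Finally the same substitution shows that the old time
    is the integral of the new speed to the power 1 - 1/k, the weight with p and
    p' exchanged ([old_time_integral]): the second time change undoes the first,
    and Tstar and Sstar exchange their roles, whence admissibility of the new triple.

    The existence of m rests on Radon-Nikodym: a real function whose increments
    are bounded by the integrals of w is a difference of two monotone functions
    with Stieltjes measures dominated by 2 w ([ac_density]), and m is the
    supremum of the densities of the distances to a dense sequence of points of
    the curve ([metric_speed_exists]). *)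

(** * Semicontinuity of the slope of a convex functional *)

Section metric_space.
Context {R : realType} {S : metricType R}.

Lemma mdist_near (x : S) (e : R) : 0 < e -> \forall y \near x, mdist x y < e.
Proof.
move=> e0; apply/metricType_numDomainType.nbhs_mdistP.
by exists e.
Qed.

Lemma ler_dist_mdist (x y z : S) : `|mdist x z - mdist y z| <= mdist x y.
Proof.
rewrite ler_norml; apply/andP; split.
  by have := metric_triangle y x z; rewrite (metric_sym y x); lra.
by have := metric_triangle x y z; lra.
Qed.

Lemma mdist_continuous (y : S) : continuous (fun x : S => mdist x y : R).
Proof.
move=> x; apply/cvgrPdist_lt => e e0.
have := mdist_near x e0; apply: filterS => z xz.
exact: le_lt_trans (ler_dist_mdist _ _ _) xz.
Qed.

End metric_space.

Section slope.
Context {R : realType} {S : completeMetricType R}.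
Variables (f : S -> \bar R) (p0 lambda : R).
Hypotheses (f_gtNy : forall v, (-oo < f v)%E) (lambda_lt0 : lambda < 0).

Lemma local_slope_ge0 v : (0 <= local_slope f v)%E.
Proof. by rewrite /local_slope; case: ifP => _; rewrite ?le0y// le_max lexx. Qed.

Lemma fin_numf v : (f v < +oo)%E -> f v \is a fin_num.
Proof. by move=> fv; rewrite fin_real// f_gtNy. Qed.

(** On the curve joining [v] to [w], whose distance to [v] is at most linear,
    the functional falls below its chord up to the correction in [lambda], so
    the difference quotients at [v] are at least [(f v - f w + lambda d^p0) / d].
    As [lambda < 0], dropping [psi] weakens the convexity inequality. *)
Lemma slope_upper v w (c : R) : 0 < p0 -> pl_convex f p0 lambda ->
  (f v < +oo)%E -> (f w < +oo)%E -> (local_slope f v <= c%:E)%E ->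
  fine (f v) - fine (f w) <= c * mdist v w + - lambda * mdist v w `^ p0.
Proof.
move=> p00 [psi [psi01 _ _ H]] fv fw slv; rewrite leNgt; apply/negP => C.
set d := mdist v w in C.
have c0 : 0 <= c by rewrite -lee_fin; exact: le_trans (local_slope_ge0 v) slv.
have d0 : 0 < d.
  rewrite /d mdist_gt0; apply/eqP => vw; move: C.
  by rewrite /d vw mdistxx mulr0 powR0 ?gt_eqF// mulr0 addr0 subrr ltxx.
pose D := fine (f v) - fine (f w) + lambda * d `^ p0.
have D0 : c * d < D by rewrite /D; lra.
have D00 : 0 < D by apply: le_lt_trans D0; rewrite mulr_ge0 // ltW.
have [gamma [_ _ _ Hg]] := H v w.
have {}Hg (t : R) : 0 < t <= 1 -> mdist v (gamma t) <= t * d /\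
    (f (gamma t) <= (fine (f v) - t * D)%:E)%E.
  move=> /andP[t0 t1]; have t01 : 0 <= t <= 1 by rewrite ltW.
  have [] := Hg _ t01; rewrite (metric_sym (gamma t)) !(metric_sym w v) => h1 h2.
  split => //; apply: le_trans h2 _.
  rewrite -(fineK (fin_numf fv)) -(fineK (fin_numf fw)).
  rewrite -?EFinM -?EFinD -?EFinN -?EFinD lee_fin /D /=.
  have /andP[ps0 ps1] := psi01 _ t01.
  have q0 : 0 <= - lambda * t * psi t * d `^ p0.
    by rewrite !mulr_ge0 ?powR_ge0 ?oppr_ge0// ltW.
  rewrite -subr_ge0; rewrite (_ : _ - _ = - lambda * t * psi t * d `^ p0)//.
  by rewrite -/d; ring.
clearbody D.
have Q (t : R) : 0 < t <= 1 -> v != gamma t /\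
   ((D / d)%:E <= maxe (f v - f (gamma t)) 0 * ((mdist v (gamma t))^-1)%:E)%E.
  move=> t01; have [h1 h2] := Hg _ t01; case/andP : t01 => t0 t1.
  have fg : (f (gamma t) < +oo)%E by apply: le_lt_trans h2 _; rewrite ltry.
  move: h2; rewrite -(fineK (fin_numf fv)) -(fineK (fin_numf fg)) lee_fin => h2.
  have tD0 : 0 < t * D by rewrite mulr_gt0.
  have vg : v != gamma t.
    by apply/eqP => e; move: h2; rewrite -e; lra.
  split => //.
  have dg0 : 0 < mdist v (gamma t) by rewrite mdist_gt0.
  rewrite -EFinB -EFin_max -EFinM lee_fin ler_pdivlMr// mulrAC ler_pdivrMr//.
  rewrite maxElt; case: ltP => [hm|_]; first by lra.
  apply: (@le_trans _ _ (D * (t * d))); first by rewrite ler_wpM2l// ltW.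
  rewrite mulrCA mulrA ler_wpM2r ?(ltW d0)// lerBrDr -lerBrDl; lra.
have {slv} : (limf_esup (fun w => maxe (f v - f w) 0 * ((mdist v w)^-1)%:E)
   v^' <= c%:E)%E.
  by apply: le_trans slv; rewrite /local_slope fv le_max lexx orbT.
rewrite leNgt => /negP; apply.
apply: (@lt_le_trans _ _ (D / d)%:E); first by rewrite lte_fin ltr_pdivlMr.
rewrite limf_esupE; apply: le_ereal_inf_tmp => _ [A + <-].
rewrite /dnbhs /within/= => /metricType_numDomainType.nbhs_mdistP[e /= e0 eA].
pose t := Num.min 1 (e / (2 * d)).
have t0 : 0 < t by rewrite lt_min ltr01 divr_gt0 // mulr_gt0.
have t1 : 0 < t <= 1 by rewrite t0 ge_min lexx.
have [h1 _] := Hg _ t1; have [h2 h3] := Q _ t1.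
apply: le_trans h3 _; apply: ereal_sup_ubound; exists (gamma t) => //.
apply: eA => /=; last by rewrite eq_sym.
apply: le_lt_trans h1 _; apply: (@le_lt_trans _ _ (e / (2 * d) * d)).
  by rewrite ler_wpM2r ?(ltW d0)// ge_min lexx orbT.
by rewrite invfM mulrA -mulrA mulVf ?gt_eqF// mulr1; lra.
Qed.

Lemma slope_witness v (c delta : R) : 0 <= c -> 0 < delta ->
  (f v < +oo)%E -> (c%:E < local_slope f v)%E ->
  exists w, [/\ 0 < mdist v w, mdist v w < delta, (f w < +oo)%E &
    c * mdist v w < fine (f v) - fine (f w)].
Proof.
move=> c0 de0 fv; rewrite /local_slope fv lt_max lte_fin (ltNge c) c0/=.
move=> h.
have := @lt_le_trans _ _ _ _ _ h.
rewrite limf_esupE => /(_ _ (ereal_inf_lbound _)) => {}h.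
have /h : [set ereal_sup [set maxe (f v - f w) 0 * ((mdist v w)^-1)%:E | w in V]%E
   | V in (v^')] (ereal_sup
   [set maxe (f v - f w) 0 * ((mdist v w)^-1)%:E | w in [set w | (0 < mdist v w < delta)%R]])%E.
  exists [set w | 0 < mdist v w < delta] => //.
  rewrite /dnbhs /within/=; have := mdist_near v de0; apply: filterS => w vw wv.
  by rewrite vw mdist_gt0 eq_sym wv.
move=> /ereal_sup_gt[_ [w /= /andP[w0 wd] <-]] hw.
exists w; have fw : (f w < +oo)%E.
  rewrite ltNge leye_eq; apply/eqP => fw; move: hw.
  rewrite fw -(fineK (fin_numf fv)) /= maxElt /= ltNy0 mul0e.
  by rewrite lte_fin ltNge c0.
split => //.
move: hw; rewrite -(fineK (fin_numf fv)) -(fineK (fin_numf fw)).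
rewrite -EFinB -EFin_max -EFinM lte_fin ltr_pdivlMr//= lt_max.
by rewrite (ltNge _ 0) (mulr_ge0 c0 (ltW w0)) orbF.
Qed.

(** Convexity turns the slope, a local quantity, into a supremum of lower
    semicontinuous ones: a witness of a large slope at [v] stays a witness
    near [v]. *)
Lemma slope_lsc v (c : R) : 1 < p0 -> pl_convex f p0 lambda ->
  lower_semicontinuous f -> 0 <= c ->
  (f v < +oo)%E -> (c%:E < local_slope f v)%E ->
  \forall w \near v, (c%:E < local_slope f w)%E.
Proof.
move=> p01 cvx lsc c0 fv cs.
have p00 : 0 < p0 by lra.
have [c' cc' c's] : exists2 c' : R, c < c' & (c'%:E < local_slope f v)%E.
  move: cs; case: (local_slope f v) => [r| |//].
    by rewrite lte_fin => cr; exists ((c + r) / 2); rewrite ?lte_fin; lra.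
  by move=> _; exists (c + 1); rewrite ?ltry; lra.
pose A := (c' - c) / - lambda.
have A0 : 0 < A by rewrite divr_gt0 ?subr_gt0 ?oppr_gt0.
pose delta := A `^ (p0 - 1)^-1.
have [w [d0 dd fw hw]] := slope_witness (le_trans c0 (ltW cc')) (powR_gt0 _ A0 : 0 < delta) fv c's.
set d := mdist v w in d0 dd hw.
have dA : - lambda * d `^ p0 <= (c' - c) * d.
  rewrite -(@mulr_powRB1 _ d p0) ?(ltW d0)// mulrCA (mulrC (c' - c) d) ler_wpM2l ?(ltW d0)//.
  rewrite mulrC -ler_pdivlMr ?oppr_gt0//.
  apply: (@le_trans _ _ (delta `^ (p0 - 1))).
    by rewrite ge0_ler_powR ?nnegrE ?subr_ge0 ?(ltW d0) ?(ltW dd) ?powR_ge0 ?(ltW p01).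
  by rewrite /delta -powRrM mulVf ?powRr1 ?(ltW A0)// gt_eqF // subr_gt0.
pose G (x : R) := c * x + - lambda * x `^ p0.
have GE : G d < fine (f v) - fine (f w) by rewrite /G; lra.
pose E := (fine (f v) - fine (f w) - G d) / 2.
have E0 : 0 < E by rewrite divr_gt0// subr_gt0.
have cG : {for d, continuous G}.
  apply: differentiable_continuous; apply/derivable1_diffP.
  apply: derivableD; first exact: derivableM.
  apply: derivableM => //; apply: derivable_powR.
  by rewrite in_itv/= d0.
have cGd : {for v, continuous (fun x => G (mdist x w))}.
  by apply: (@continuous_comp _ _ _ (fun x : S => mdist x w : R) G) => //; exact: mdist_continuous.
have nG : \forall x \near v, G (mdist x w) < G d + E.
  move/cvgrPdist_lt : cGd => /(_ _ E0); apply: filterS => x.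
  rewrite -/d ltr_norml => /andP[+ _]; lra.
have /lsc [V vV hV] : ((fine (f v) - E)%:E < f v)%E.
  by rewrite -[ltRHS](fineK (fin_numf fv)) lte_fin; lra.
near=> x.
rewrite ltNge; apply/negP => xc.
have fx : (f x < +oo)%E.
  by rewrite ltNge; apply/negP => fx; move: xc; rewrite /local_slope ltNge fx.
have := slope_upper p00 cvx fx fw xc.
rewrite leNgt => /negP; apply; rewrite -/(G _).
have Gx : G (mdist x w) < G d + E by near: x.
apply: lt_trans Gx _.
have : ((fine (f v) - E)%:E < f x)%E by apply: hV; near: x.
rewrite -[ltRHS](fineK (fin_numf fx)) lte_fin /E; lra.
Unshelve. all: by end_near. Qed.

End slope.

(** * Densities of absolutely continuous functions *)

Section lebesgue_stieltjes_density.
Context {R : realType}.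
Local Notation mu := (@lebesgue_measure R).

Lemma eq_measure_ocitv (m1 m2 : {measure set (measurableTypeR R) -> \bar R}) :
  (forall a b : R, a <= b -> m1 `]a, b]%classic = m2 `]a, b]%classic) ->
  (forall a b : R, (m1 `]a, b]%classic < +oo)%E) ->
  forall A, measurable A -> m1 A = m2 A.
Proof.
move=> m12 m1oo A mA.
apply: (@measure_unique _ R (measurableTypeR R) (@ocitv R) (fun k : nat => `]- k%:R, k%:R]%classic) _ _ _ _ m1 m2) => //.
- exact: ocitvI.
- by move=> k; exact: is_ocitv.
- exact: bigcup_itvT.
- move=> _ [[a b] _ <-] /=; have [/m12//|ba] := leP a b.
  by rewrite set_itv_ge ?measure0// bnd_simp -leNgt ltW.
Qed.

Definition mk_cumulative (F : R -> R) (nd : nondecreasing F)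
    (rc : right_continuous F) : cumulative R R :=
  HB.pack F (isCumulative.Build R _ R F nd rc).

Lemma lebesgue_stieltjes_ocitv (F : cumulative R R) (a b : R) : a <= b ->
  lebesgue_stieltjes_measure F `]a, b]%classic = (F b - F a)%:E.
Proof.
move=> ab; rewrite /lebesgue_stieltjes_measure /measure_extension/=.
rewrite measurable_mu_extE/=; last exact: is_ocitv.
by rewrite wlength_itv_bnd.
Qed.

Section density.
Variable w : R -> R.
Hypotheses (w0 : forall x, 0 <= w x) (iw : mu.-integrable setT (EFin \o w)).

Let mw D : measurable_fun D (EFin \o w).
Proof. by apply: (@measurable_funS _ _ _ _ setT) => //; exact: (measurable_int mu iw). Qed.

Let nu0 (E : set (measurableTypeR R)) : (0 <= induced_charge iw E)%E.
Proof. by apply: integral_ge0 => x _; rewrite lee_fin. Qed.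

(** Built from the charge induced by [w], to which the Radon-Nikodym theorem
    applies. *)
Definition density_measure : set (measurableTypeR R) -> \bar R :=
  measure_of_charge (induced_charge iw) nu0.

HB.instance Definition _ := Measure.on density_measure.

Lemma density_measureE A : density_measure A = (\int[mu]_(x in A) (w x)%:E)%E.
Proof. by []. Qed.

Let fin : fin_num_fun density_measure.
Proof.
move=> A mA; rewrite density_measureE.
by apply: (integrable_fin_num mA); apply: integrableS iw.
Qed.

HB.instance Definition _ := @Measure_isFinite.Build _ _ _ density_measure fin.

Lemma density_measure_dominates : density_measure `<< mu.
Proof.
apply/null_content_dominatesP => A mA A0; rewrite density_measureE.
apply: null_set_integral => //; exact: mw.
Qed.

(** The Radon-Nikodym derivative of this measure is [w] almost everywhere,
    its integrals over all measurable sets being those of [w]. *)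
Lemma ge0_integral_density (D : set R) (f : R -> \bar R) : measurable D ->
  measurable_fun setT f -> (forall x, 0 <= f x)%E ->
  (\int[density_measure]_(x in D) f x = \int[mu]_(x in D) (f x * (w x)%:E))%E.
Proof.
move=> mD mf f0.
rewrite -(Radon_Nikodym_SigmaFinite.change_of_variables density_measure_dominates)//;
  last exact: measurable_funTS.
have mg : measurable_fun D (Radon_Nikodym_SigmaFinite.f density_measure mu).
  exact: measurable_funTS (measurable_int _ (Radon_Nikodym_SigmaFinite.f_integrable density_measure_dominates)).
apply: ge0_ae_eq_integral => //.
- by apply: emeasurable_funM; [exact: measurable_funTS|first [exact: mg|exact: mw]].
- by apply: emeasurable_funM; [exact: measurable_funTS|first [exact: mg|exact: mw]].
- by move=> x _; apply: mule_ge0 => //; apply: Radon_Nikodym_SigmaFinite.f_ge0; exact: density_measure_dominates.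
- by move=> x _; rewrite mule_ge0// lee_fin.
have : ae_eq mu D (Radon_Nikodym_SigmaFinite.f density_measure mu) (EFin \o w).
  apply: integral_ae_eq.
  - exact: mD.
  - exact: integrableS (Radon_Nikodym_SigmaFinite.f_integrable density_measure_dominates).
  - exact: mw.
  - by move=> E ED mE; rewrite -(Radon_Nikodym_SigmaFinite.f_integral density_measure_dominates).
by apply: filterS => x /[apply] ->.
Qed.

End density.

Section increments.
Variable w : R -> R.
Hypotheses (w0 : forall x, 0 <= w x) (iw : mu.-integrable setT (EFin \o w)).
Local Notation W s t := (\int[mu]_(r in `]s, t]) w r)%R.

Let iwS (D : set R) : measurable D -> mu.-integrable D (EFin \o w).
Proof. by move=> mD; apply: integrableS iw. Qed.

Lemma primitive_increment s t : s <= t ->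
  (\int[mu]_(r in `]-oo, t]) w r - \int[mu]_(r in `]-oo, s]) w r = W s t)%R.
Proof.
by move=> st; rewrite Rintegral_itvB//= ?bnd_simp//; exact: iwS.
Qed.

(** Feeds the Stieltjes construction, which asks for right continuity. *)
Lemma increment_right_continuous (C : R) (H : R -> R) : 0 <= C ->
  (forall s t, s <= t -> `|H t - H s| <= C * W s t) -> right_continuous H.
Proof.
move=> C0 HW x; apply/cvgrPdist_le => e e0.
have iwx : mu.-integrable `[x, x + 1] (EFin \o w) by exact: iwS.
have xx1 : x < x + 1 by rewrite ltrDl.
have /cvgrPdist_le/(_ (e / (C + 1))) := parameterized_integral_cvg_left xx1 iwx.
rewrite divr_gt0 ?ltr_wpDl// => /(_ isT) h.
near=> y.
have xy : x <= y by near: y; exact: nbhs_right_ge.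
rewrite distrC (le_trans (HW _ _ xy))//.
have : `|0 - parameterized_integral mu x y w| <= e / (C + 1).
  by near: y; apply: cvg_within.
rewrite /parameterized_integral sub0r normrN -Rintegral_itv_obnd_cbnd; last exact: iwS.
rewrite ger0_norm ?Rintegral_ge0// => h1.
apply: (@le_trans _ _ (C * (e / (C + 1)))); first by rewrite ler_wpM2l.
rewrite mulrCA ler_piMr// ?(ltW e0)// ler_pdivrMr ?ltr_wpDl// mul1r.
by rewrite lerDl.
Unshelve. all: by end_near. Qed.

(** The increments of [phi] are split between the two nondecreasing functions
    [M + phi] and [M - phi], where [M] is a primitive of [w]; their Stieltjes
    measures add up to the measure with density [2 w], so both are absolutely
    continuous. *)
Lemma ac_density (phi : R -> R) :
  (forall s t, s <= t -> `|phi t - phi s| <= W s t) ->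
  exists2 rho : R -> R, mu.-integrable setT (EFin \o rho) &
    forall s t, s <= t -> (phi t - phi s = \int[mu]_(r in `]s, t]) rho r)%R.
Proof.
move=> phiW.
pose M t := (\int[mu]_(r in `]-oo, t]) w r)%R.
have MW s t : s <= t -> M t - M s = W s t by exact: primitive_increment.
have ndF : nondecreasing (fun t => M t + phi t).
  by move=> s t st; have := phiW _ _ st; rewrite ler_norml -MW// => /andP[]; lra.
have ndG : nondecreasing (fun t => M t - phi t).
  by move=> s t st; have := phiW _ _ st; rewrite ler_norml -MW// => /andP[]; lra.
have rcF : right_continuous (fun t => M t + phi t).
  apply: (@increment_right_continuous 2) => // s t st.
  by have := phiW _ _ st; rewrite -MW// !ler_norml => /andP[? ?]; apply/andP; split; lra.
have rcG : right_continuous (fun t => M t - phi t).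
  apply: (@increment_right_continuous 2) => // s t st.
  by have := phiW _ _ st; rewrite -MW// !ler_norml => /andP[? ?]; apply/andP; split; lra.
pose F := mk_cumulative ndF rcF; pose G := mk_cumulative ndG rcG.
pose nuF := lebesgue_stieltjes_measure F.
pose nuG := lebesgue_stieltjes_measure G.
have w20 x : 0 <= 2 * w x by rewrite mulr_ge0.
have iw2 : mu.-integrable setT (EFin \o (fun x => 2 * w x)).
  have : mu.-integrable setT (fun x => 2%:E * (EFin \o w) x)%E by exact: integrableZl.
  by apply: eq_integrable.
have nuFG A : measurable A -> measure_add nuF nuG A = density_measure w20 iw2 A.
  apply: eq_measure_ocitv => a b => [ab|].
    transitivity (nuF `]a, b]%classic + nuG `]a, b]%classic)%E; first exact: measure_addE.
    transitivity (\int[mu]_(x in `]a, b]) (2 * w x)%:E)%E; last by [].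
    rewrite /nuF /nuG !lebesgue_stieltjes_ocitv//.
    rewrite -EFinD /F /G /=.
    under [RHS]eq_integral do rewrite EFinM.
    rewrite integralZl//; last exact: iwS.
    rewrite -[(\int[_]_(_ in _) _)%E]fineK; last by apply: integrable_fin_num => //; exact: iwS.
    rewrite -EFinM; congr EFin; rewrite -[fine _]/(W a b) -MW//; lra.
  have [ab|ba] := leP a b; last by rewrite set_itv_ge ?measure0 ?ltry// bnd_simp -leNgt ltW.
  apply: (@le_lt_trans _ _ (nuF `]a, b]%classic + nuG `]a, b]%classic)%E).
    by rewrite le_eqVlt; apply/orP; left; apply/eqP; exact: measure_addE.
  by rewrite /nuF /nuG !lebesgue_stieltjes_ocitv// -EFinD ltry.
have nuFle A : measurable A -> (nuF A <= density_measure w20 iw2 A)%E.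
  move=> mA; rewrite -nuFG//; apply: (@le_trans _ _ (nuF A + nuG A)%E).
    by rewrite leeDl.
  by rewrite le_eqVlt; apply/orP; left; apply/eqP/esym; exact: measure_addE.
have finF : fin_num_fun nuF.
  move=> A mA; rewrite ge0_fin_numE//; apply: le_lt_trans (nuFle _ mA) _.
  by rewrite -ge0_fin_numE//; exact: fin_num_measure.
pose nuF' : {finite_measure set (measurableTypeR R) -> \bar R} :=
  HB.pack nuF (@Measure_isFinite.Build _ _ _ nuF finF).
have dF : nuF' `<< mu.
  apply/null_content_dominatesP => A mA A0; apply/eqP.
  rewrite eq_le measure_ge0 andbT (le_trans (nuFle _ mA))//.
  have /null_content_dominatesP -> // := density_measure_dominates w20 iw2.
have [r [r0 rfin ir rE]] := radon_nikodym_sigma_finite dF.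
exists (fun x => fine (r x) - w x).
  have : mu.-integrable setT (r \- (EFin \o w))%E by exact: integrableB.
  by apply: eq_integrable => // x _ /=; rewrite EFinB fineK.
move=> s t st.
have ir' D : measurable D -> mu.-integrable D (EFin \o (fine \o r)).
  move=> mD; have : mu.-integrable D r by apply: integrableS ir.
  by apply: eq_integrable => // x _ /=; rewrite fineK.
rewrite RintegralB//; [|exact: ir'|exact: iwS].
rewrite -MW//.
suff -> : (\int[mu]_(x in `]s, t]) fine (r x))%R = F t - F s by rewrite /F/=; lra.
rewrite /Rintegral; under eq_integral do rewrite fineK//.
rewrite -rE//; transitivity (fine (nuF `]s, t]%classic)) => //.
by rewrite /nuF lebesgue_stieltjes_ocitv.
Qed.

End increments.
End lebesgue_stieltjes_density.

(** * Metric derivative of an absolutely continuous curve *)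

Section difference_quotients.
Context {R : realType}.
Local Notation mu := (@lebesgue_measure R).

Lemma aeS (P Q : R -> Prop) : (forall x, P x -> Q x) ->
  {ae mu, forall x, P x} -> {ae mu, forall x, Q x}.
Proof. by apply: filterS; exact: (ae_filter_ringOfSetsType mu). Qed.

Lemma aeS2 (P Q T : R -> Prop) : (forall x, P x -> Q x -> T x) ->
  {ae mu, forall x, P x} -> {ae mu, forall x, Q x} -> {ae mu, forall x, T x}.
Proof. by apply: filterS2; exact: (ae_filter_ringOfSetsType mu). Qed.

Lemma is_derive_cvg_quotient (F : R -> R) (t a : R) : is_derive t (1 : R) F a ->
  (F s - F t) / (s - t) @[s --> t^'] --> a.
Proof.
move=> /is_derive1_caratheodory[g [Fg cg ga]].
have : g s @[s --> t^'] --> a by rewrite -ga; apply: cvg_within_filter; exact: cg.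
apply: cvg_trans; apply: near_eq_cvg; near=> s.
have st : s != t by near: s; exact: nbhs_dnbhs_neq.
by rewrite Fg mulfK// subr_eq0.
Unshelve. all: by end_near. Qed.

Lemma ae_is_derive_primitive (rho : R -> R) (phi : R -> R) :
  mu.-integrable setT (EFin \o rho) ->
  (forall s t, s <= t -> (phi t - phi s = \int[mu]_(r in `]s, t]) rho r)%R) ->
  {ae mu, forall t : R, is_derive t (1 : R) phi (rho t)}.
Proof.
move=> irho phiE.
have iS (D : set R) : measurable D -> mu.-integrable D (EFin \o rho).
  by move=> mD; apply: integrableS irho.
pose P t := (\int[mu]_(r in `]-oo, t]) rho r)%R.
have phiP : phi = P \+ cst (phi 0 - P 0).
  have PB s t : s <= t -> P t - P s = phi t - phi s.
    by move=> st; rewrite phiE// /P Rintegral_itvB//= ?bnd_simp//; exact: iS.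
  apply/funext => t /=; have [t0|/ltW t0] := leP 0 t.
    by have := PB _ _ t0; lra.
  by have := PB _ _ t0; lra.
have locrho : locally_integrable [set: R] rho.
  by apply: open_integrable_locally => //; exact: openT.
have := FTC1Ny (fun y => iS _ (measurable_itv _)) locrho.
apply: aeS => t [dP Pt]; rewrite phiP -[rho t]addr0.
apply: is_deriveD; rewrite -Pt derive1E.
exact: derivableP.
Qed.

End difference_quotients.

Section metric_speed.
Context {R : realType} {S : metricType R}.
Local Notation mu := (@lebesgue_measure R).
Variables (u : R -> S) (w : R -> R).
Hypotheses (w0 : forall x, 0 <= w x) (iw : mu.-integrable setT (EFin \o w)).
Hypothesis uw : forall s t, s <= t ->
  mdist (u s) (u t) <= (\int[mu]_(r in `]s, t]) w r)%R.

Let q (n : nat) : R := ratr (odflt 0%Q (unpickle n)).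

Let q_dense (s e : R) : 0 < e -> exists n, mdist (u s) (u (q n)) < e.
Proof.
move=> e0.
have rcM : right_continuous (fun t => (\int[mu]_(r in `]-oo, t]) w r)%R).
  apply: (@increment_right_continuous _ _ w0 iw 1) => // a b ab.
  rewrite primitive_increment// mul1r ger0_norm//.
  by apply: Rintegral_ge0.
have /cvgrPdist_lt/(_ _ e0)[d /= d0 hd] := rcM s.
have [x] := rat_in_itvoo (ltr_pwDr d0 (lexx s)).
rewrite in_itv/= => /andP[sx xd]; exists (pickle x).
rewrite /q pickleK /=; apply: le_lt_trans (uw (ltW sx)) _.
rewrite -primitive_increment ?(ltW sx)//.
apply: le_lt_trans (ler_norm _) _; rewrite distrC; apply: hd => //=.
by rewrite ltr0_norm; lra.
Qed.

Let phi n t := mdist (u t) (u (q n)).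

Let phiW n s t : s <= t -> `|phi n t - phi n s| <= (\int[mu]_(r in `]s, t]) w r)%R.
Proof.
move=> st; apply: le_trans (uw st); rewrite metric_sym; exact: ler_dist_mdist.
Qed.

Let rhoP n : {rho : R -> R | mu.-integrable setT (EFin \o rho) /\
    forall s t, s <= t -> (phi n t - phi n s = \int[mu]_(r in `]s, t]) rho r)%R}.
Proof.
by apply: cid; have [rho ? ?] := ac_density w0 iw (@phiW n); exists rho.
Qed.

Let rho n := sval (rhoP n).
Let irho n : mu.-integrable setT (EFin \o rho n) := (svalP (rhoP n)).1.
Let rhoE n s t : s <= t -> (phi n t - phi n s = \int[mu]_(r in `]s, t]) rho n r)%R :=
  (svalP (rhoP n)).2 s t.

(* truncation by [w] changes [`|rho n|] on a null set only, and makes the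
   supremum finite everywhere *)
Let k n x := Num.min `|rho n x| (w x).

Let k_ub t : has_ubound (range (k ^~ t)).
Proof. by exists (w t) => _ [n _ <-]; rewrite /k ge_min lexx orbT. Qed.

Let m x := sups (k ^~ x) 0.

Let k_le_m n x : k n x <= m x.
Proof. by apply: ub_le_sup; [exact: has_ubound_sdrop|exists n]. Qed.

Let m_ge0 x : 0 <= m x.
Proof. by apply: le_trans (k_le_m 0%N x); rewrite /k le_min normr_ge0 w0. Qed.

Let m_le_w x : m x <= w x.
Proof.
apply: ge_sup; first by exists (k 0 x); exists 0%N.
by move=> _ [n _ <-]; rewrite /k ge_min lexx orbT.
Qed.

Let mw : measurable_fun setT w.
Proof. by apply/measurable_EFinP; exact: (measurable_int mu iw). Qed.

Let mm : measurable_fun setT m.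
Proof.
apply: measurable_fun_sups => [t _|n]; first exact: k_ub.
apply: measurable_minr; last exact: mw.
apply: measurableT_comp => //.
by apply/measurable_EFinP; exact: (measurable_int mu (irho n)).
Qed.

Let im : mu.-integrable setT (EFin \o m).
Proof.
apply: le_integrable iw => //; first exact/measurable_EFinP.
by move=> x _ /=; rewrite lee_fin !ger0_norm.
Qed.

Let iS (g : R -> R) (D : set R) : mu.-integrable setT (EFin \o g) ->
  measurable D -> mu.-integrable D (EFin \o g).
Proof. by move=> ig mD; apply: integrableS ig. Qed.

Let rho_le_w : {ae mu, forall t, forall n, `|rho n t| <= w t}.
Proof.
apply: ae_foralln => n.
pose M t := (\int[mu]_(r in `]-oo, t]) w r)%R.
have ME s t : s <= t -> M t - M s = (\int[mu]_(r in `]s, t]) w r)%R.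
  exact: primitive_increment.
have := ae_is_derive_primitive iw ME.
have := ae_is_derive_primitive (irho n) (@rhoE n).
apply: aeS2 => t dphi dM.
have c1 := is_derive_cvg_quotient dphi; have c2 := is_derive_cvg_quotient dM.
rewrite -[leRHS](ger0_norm (w0 t)).
apply: (ler_cvg_to (cvg_norm c1) (cvg_norm c2)); near=> s.
rewrite !normrM ler_wpM2r//.
have [st|/ltW ts] := leP t s; last rewrite distrC (distrC (M s)).
  by apply: le_trans (phiW _ st) _; rewrite -ME// ler_norm.
by apply: le_trans (phiW _ ts) _; rewrite -ME// ler_norm.
Unshelve. all: by end_near. Qed.

Let um s t : s <= t -> mdist (u s) (u t) <= (\int[mu]_(r in `]s, t]) m r)%R.
Proof.
move=> st; have H n : `|phi n t - phi n s| <= (\int[mu]_(r in `]s, t]) m r)%R.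
  rewrite rhoE//; apply: (@le_trans _ _ (\int[mu]_(r in `]s, t]) `|rho n r|)%R).
    by apply: le_normr_Rintegral => //; exact: iS.
  rewrite /Rintegral fine_le//.
  - by apply: integrable_fin_num => //; apply: iS => //; exact: integrable_norm.
  - by apply: integrable_fin_num => //; exact: iS.
  have mrho : measurable_fun setT (rho n).
    by apply/measurable_EFinP; exact: (measurable_int mu (irho n)).
  apply: ae_ge0_le_integral => //.
  - by apply: measurable_funTS; apply/measurable_EFinP; exact: measurableT_comp.
  - by move=> x _; rewrite lee_fin.
  - by apply: measurable_funTS; apply/measurable_EFinP.
  apply: aeS rho_le_w => x hx _; rewrite lee_fin.
  by apply: le_trans (k_le_m n x); rewrite /k le_min lexx hx.
apply/ler_addgt0Pr => e e0.
have e20 : 0 < e / 2 by rewrite divr_gt0.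
have [n hn] := q_dense s e20.
have := H n; rewrite /phi ler_norml => /andP[h1 h2].
have := metric_triangle (u s) (u (q n)) (u t).
rewrite (metric_sym (u (q n)) (u t)); lra.
Qed.

(** The supremum of the derivatives of the distances to a dense sequence of
    points bounds the difference quotients of [u] from below; from above they
    are bounded by those of its primitive, since a distance [mdist (u s) (u t)]
    is a limit of increments of such distances. *)
Lemma metric_speed_exists : exists m : R -> R,
  [/\ measurable_fun setT m, (forall x, 0 <= m x),
      mu.-integrable setT (EFin \o m),
      (forall s t, s <= t -> mdist (u s) (u t) <= (\int[mu]_(r in `]s, t]) m r)%R) &
      {ae mu, forall t, mdist (u t) (u s) / `|t - s| @[s --> t^'] --> m t}].
Proof.
exists m; split => //.
pose P t := (\int[mu]_(r in `]-oo, t]) m r)%R.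
have PE s t : s <= t -> P t - P s = (\int[mu]_(r in `]s, t]) m r)%R.
  exact: primitive_increment.
have := ae_is_derive_primitive im PE.
have : {ae mu, forall (t : R) n, is_derive t (1 : R) (phi n) (rho n t)}.
  by apply: ae_foralln => n; apply: ae_is_derive_primitive => //; exact: rhoE.
apply: aeS2 => t dphi dP.
apply/cvgrPdist_lt => e e0.
have /is_derive_cvg_quotient c2 := dP.
have [_ [n _ <-] hn] : exists2 x, (range (k ^~ t)) x & m t - e / 2 < x.
  have e20 : 0 < e / 2 by rewrite divr_gt0.
  have [|_ [n _ <-] ?] := sup_adherent e20 (_ : has_sup (sdrop (k ^~ t) 0)).
    by split; [exists (k 0 t), 0%N|exact: has_ubound_sdrop].
  by exists (k n t) => //; exists n.
have /is_derive_cvg_quotient/cvg_norm c1 := dphi n.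
move/cvgrPdist_lt : c1 => /(_ (e / 2)); rewrite divr_gt0// => /(_ isT) c1.
move/cvgrPdist_lt : c2 => /(_ e e0) c2.
near=> s.
have st : s != t by near: s; exact: nbhs_dnbhs_neq.
have st0 : 0 < `|t - s| by rewrite normr_gt0 subr_eq0 eq_sym.
have h1 : `| `|rho n t| - `|(phi n s - phi n t) / (s - t)| | < e / 2.
  by near: s; exact: c1.
have h2 : `|m t - (P s - P t) / (s - t)| < e by near: s; exact: c2.
have h3 : k n t <= `|rho n t| by rewrite /k ge_min lexx.
have h4 : `|(phi n s - phi n t) / (s - t)| <= mdist (u t) (u s) / `|t - s|.
  rewrite normrM normfV (distrC s) ler_wpM2r//.
  rewrite metric_sym; exact: ler_dist_mdist.
have h5 : mdist (u t) (u s) / `|t - s| <= (P s - P t) / (s - t).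
  have [ts|/ltW ts] := leP t s.
    rewrite distrC ger0_norm ?subr_ge0// ler_wpM2r ?invr_ge0 ?subr_ge0//.
    by rewrite PE//; exact: um.
  rewrite ger0_norm ?subr_ge0// -(opprB (P t)) -(opprB t s) invrN mulrNN.
  rewrite ler_wpM2r ?invr_ge0 ?subr_ge0//.
  by rewrite PE// metric_sym; exact: um.
rewrite ltr_norml; apply/andP; split.
  by move: h2; rewrite ltr_norml => /andP[]; lra.
by move: h1; rewrite ltr_norml => /andP[]; lra.
Unshelve. all: by end_near. Qed.

End metric_speed.

Section ACloc_speed.
Context {R : realType} {S : completeMetricType R}.
Local Notation mu := (@lebesgue_measure R).

Let clamp (N : nat) (t : R) : R := Num.max 0 (Num.min t N%:R).

Let clamp_id N t : 0 <= t <= N%:R -> clamp N t = t.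
Proof. by move=> /andP[t0 tN]; rewrite /clamp min_l// max_r. Qed.

Let clamp_itv N t : 0 <= clamp N t <= N%:R.
Proof. by rewrite /clamp le_max lexx/= ge_max ler0n/= ge_min lexx orbT. Qed.

Let clamp_le N s t : s <= t -> clamp N s <= clamp N t.
Proof.
by move=> st; rewrite /clamp ge_max !le_max lexx/= le_min !ge_min st lexx/= ?orbT.
Qed.

Let clamp_sub N s t x : clamp N s < x <= clamp N t -> s < x <= t.
Proof.
rewrite /clamp gt_max le_max => /andP[/andP[x0 sx]].
rewrite [x <= 0]leNgt x0/= le_min => /andP[-> xN]; rewrite andbT.
by move: sx; rewrite gt_min => /orP[//|]; rewrite ltNge xN.
Qed.

(** The majorant is cut off outside of [`[0, N]], where the frozen curve does
    not move. *)
Let ACloc_speed_on (u : R -> S) (N : nat) : ACloc +oo%E u ->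
  exists m : R -> R,
  [/\ measurable_fun setT m, (forall x, 0 <= m x),
      mu.-integrable setT (EFin \o m),
      (forall s t, 0 <= s -> s <= t -> t <= N%:R ->
         mdist (u s) (u t) <= (\int[mu]_(r in `]s, t]) m r)%R) &
      {ae mu, forall t, 0 < t < N%:R ->
         mdist (u t) (u s) / `|t - s| @[s --> t^'] --> m t}].
Proof.
move=> [m0 [im0 um0]].
pose J : set R := `[0, N%:R]%classic.
have iJ : mu.-integrable J (EFin \o m0).
  apply: im0; first exact: segment_compact.
  by move=> x; rewrite /J /= in_itv/= /itv0/= => /andP[-> _]; rewrite ltry.
pose w := (fun x => `|m0 x|) \_ J.
have w0 x : 0 <= w x by rewrite /w patchE; case: ifP.
have iw : mu.-integrable setT (EFin \o w).
  rewrite /w -restrict_EFin; have mJ : measurable J by exact: measurable_itv.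
  exact: ((@integrable_mkcond _ _ _ mu J _ mJ).1 (integrable_norm iJ)).
have vw s t : s <= t ->
    mdist ((u \o clamp N) s) ((u \o clamp N) t) <= (\int[mu]_(r in `]s, t]) w r)%R.
  move=> st /=; have /andP[a0 aN] := clamp_itv N s.
  have /andP[b0 bN] := clamp_itv N t; have ab := clamp_le N st.
  set a := clamp N s in a0 aN ab *; set b := clamp N t in b0 bN ab *.
  have iw' (D : set R) : measurable D -> mu.-integrable D (EFin \o w).
    by move=> mD; apply: integrableS iw.
  have abJ : `[a, b] `<=` J.
    move=> x; rewrite /J /= !in_itv/= => /andP[ax xb].
    by rewrite (le_trans a0 ax) (le_trans xb bN).
  have mw : measurable_fun setT w.
    by apply/measurable_EFinP; exact: (measurable_int mu iw).
  rewrite -lee_fin /Rintegral fineK; last first.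
    by apply: integrable_fin_num => //; exact: iw'.
  have := um0 a b; rewrite /itv0/= a0 b0 !ltry => /(_ (conj isT isT) (conj isT isT) ab).
  move=> /le_trans; apply.
  apply: (@le_trans _ _ (\int[mu]_(r in `[a, b]) (w r)%:E)%E).
    apply: le_integral => //.
    - apply: integrableS iJ => //; exact: measurable_itv.
    - exact: iw'.
    move=> x; rewrite inE => /abJ xJ; rewrite lee_fin /w patchE mem_set//.
    exact: ler_norm.
  rewrite -integral_itv_obnd_cbnd; last by apply: measurable_funTS; apply/measurable_EFinP.
  apply: ge0_subset_integral => //.
  - by apply: measurable_funTS; apply/measurable_EFinP.
  - by move=> x _; rewrite lee_fin.
  - by move=> x /=; rewrite !in_itv/=; exact: clamp_sub.
have [m [mm mge0 im um lm]] := metric_speed_exists w0 iw vw.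
exists m; split => //.
  move=> s t s0 st tN; have := um _ _ st => /=.
  by rewrite !clamp_id ?s0 ?(le_trans st tN)// ?tN ?(le_trans s0 st).
apply: aeS lm => t + /andP[t0 tN].
apply: cvg_trans; apply: near_eq_cvg; near=> s.
rewrite /= (@clamp_id _ t) ?(ltW t0) ?(ltW tN)//.
rewrite clamp_id//.
have : `]0, N%:R[%classic s.
  near: s; apply: cvg_within; apply: (@near_in_itvoo R 0 N%:R).
  by rewrite in_itv/= t0 tN.
by rewrite /= in_itv/= => /andP[/ltW -> /ltW ->].
Unshelve. all: by end_near. Qed.

(** The curve frozen outside of [`[0, N]] is absolutely continuous on the whole
    line. The speeds obtained for different [N] agree almost everywhere, being
    the same limits, and are glued along the intervals [`[n, n + 1[]. *)
Lemma ACloc_speed (u : R -> S) : ACloc +oo%E u ->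
  exists m : R -> R,
  [/\ measurable_fun setT m, (forall x, 0 <= m x),
      (forall T : R, mu.-integrable `[0, T] (EFin \o m)),
      (forall s t, 0 <= s -> s <= t ->
         mdist (u s) (u t) <= (\int[mu]_(r in `]s, t]) m r)%R) &
      {ae mu, forall t, 0 < t ->
         mdist (u t) (u s) / `|t - s| @[s --> t^'] --> m t}].
Proof.
move=> acu.
have {acu} /= /(_ _)/cid - /all_sig[M] := fun N => @ACloc_speed_on u N acu.
move=> /all_and5[mM M0 iM uM lM].
pose m := (fun t : R => M (Num.truncn t).+1 t) \_ `[0, +oo[.
have m0 x : 0 <= m x by rewrite /m patchE; case: ifP.
have mm : measurable_fun setT m.
  apply/(measurable_restrictT _ _).1 => //.
  have -> : `[0, +oo[%classic = \bigcup_n `[n%:R, n.+1%:R[%classic :> set R.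
    apply/seteqP; split => [x /=|x [n _] /=]; rewrite !in_itv/= ?andbT => x0.
      by exists (Num.truncn x) => //=; rewrite in_itv/= truncn_itv.
    by case/andP : x0 => + _; apply: le_trans.
  apply/measurable_fun_bigcup => // n.
  apply: (eq_measurable_fun (M n.+1)); last exact: measurable_funTS.
  by move=> x; rewrite inE/= in_itv/= => /truncn_def ->.
have lM' : {ae mu, forall (t : R) n, 0 < t < n%:R ->
    mdist (u t) (u s) / `|t - s| @[s --> t^'] --> M n t}.
  exact: ae_foralln.
have trE (t : R) : 0 < t -> 0 < t < (Num.truncn t).+1%:R.
  by move=> t0; rewrite t0 /= truncnS_gt.
have mE : {ae mu, forall (t : R) n, 0 < t < n%:R -> M n t = m t}.
  apply: aeS lM' => t h n tn; have /andP[t0 _] := tn.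
  rewrite /m patchE mem_set/= ?in_itv/= ?(ltW t0)//.
  exact: (cvg_unique _ (h _ tn) (h _ (trE _ t0))).
have mE' n (a b : R) : 0 <= a -> b <= n%:R ->
    (\int[mu]_(r in `]a, b]) (m r)%:E = \int[mu]_(r in `]a, b]) (M n r)%:E)%E.
  move=> a0 bn.
  rewrite -!integral_itv_bndo_bndc; last 2 first.
  - by apply: measurable_funTS; apply/measurable_EFinP; first [exact: mM|exact: mm].
  - by apply: measurable_funTS; apply/measurable_EFinP; first [exact: mM|exact: mm].
  apply: ge0_ae_eq_integral => //.
  - by apply: measurable_funTS; apply/measurable_EFinP.
  - by apply: measurable_funTS; apply/measurable_EFinP; exact: mM.
  - by move=> x _; rewrite lee_fin.
  - by move=> x _; rewrite lee_fin.
  apply: aeS mE => x /(_ n) h; rewrite /= in_itv/= => /andP[ax xb].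
  by rewrite h// (le_lt_trans a0 ax) (lt_le_trans xb bn).
exists m; split => //.
- move=> T; apply/integrableP; split.
    by apply: measurable_funTS; apply/measurable_EFinP.
  rewrite -integral_itv_obnd_cbnd; last first.
    apply: measurable_funTS; apply: measurableT_comp => //.
    exact/measurable_EFinP.
  pose n := (Num.truncn T).+1.
  have Tn : T <= n%:R by rewrite ltW// truncnS_gt.
  under eq_integral do rewrite /= ger0_norm//.
  rewrite (@mE' n)// -ge0_fin_numE; last by apply: integral_ge0 => x _; rewrite lee_fin.
  by apply: integrable_fin_num => //; apply: integrableS (iM n).
- move=> s t s0 st; pose n := (Num.truncn t).+1.
  have tn : t <= n%:R by rewrite ltW// truncnS_gt.
  by rewrite /Rintegral (mE' n)//; exact: uM.
apply: aeS2 lM' mE => t h h' t0.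
by rewrite -(h' _ (trE _ t0)); exact: h (trE _ t0).
Qed.

End ACloc_speed.

(** * Increments of monotone functions and change of time *)

Section monotone_derivative.
Context {R : realType}.
Local Notation mu := (@lebesgue_measure R).

Lemma ge0_integral_shift (f : R -> R) (a b e : R) :
  measurable_fun setT f -> (forall x, 0 <= f x) -> a <= b ->
  (\int[mu]_(x in `]a, b]) (f (x + e)%R)%:E =
   \int[mu]_(x in `](a + e)%R, (b + e)%R]) (f x)%:E)%E.
Proof.
move=> mf f0 ab.
pose sh := (fun x => x + e) : measurableTypeR R -> measurableTypeR R.
have msh : measurable_fun setT sh.
  by apply: (@nondecreasing_measurable R) => // x y xy; rewrite lerD2r.
have pre c d : sh @^-1` `](c + e), (d + e)] = `]c, d]%classic.
  by apply/seteqP; split => x; rewrite /= !in_itv/= /sh ltrD2r lerD2r.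
have shE A : measurable A -> pushforward mu sh A = mu A.
  apply: (@eq_measure_ocitv R (measure_function_pushforward__canonical__measure_function_Measure mu msh) mu).
    move=> c d cd /=; rewrite /pushforward -(subrK e c) -(subrK e d) pre.
    by rewrite !lebesgue_measure_itv/= !lte_fin -!EFinB ltrD2r; congr (if _ then _%:E else _); lra.
  move=> c d /=; rewrite /pushforward -(subrK e c) -(subrK e d) pre.
  by rewrite lebesgue_measure_itv/=; case: ifP; rewrite ?ltry// -EFinB ltry.
transitivity (\int[pushforward mu sh]_(x in `](a + e)%R, (b + e)%R]) (f x)%:E)%E.
  rewrite ge0_integral_pushforward//=.
  - by rewrite pre.
  - by apply: measurable_funTS; apply/measurable_EFinP.
  - by move=> x _; rewrite lee_fin.
by apply: eq_measure_integral => A mA _; exact: shE.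
Qed.

Let mu_itv_lty (x y : R) : (mu `]x, y]%classic < +oo)%E.
Proof. by rewrite lebesgue_measure_itv/=; case: ifP; rewrite ?ltry// -EFinB ltry. Qed.

Lemma limn_einf_le (v : (\bar R)^nat) (c : \bar R) :
  (forall n, (v n <= c)%E) -> (limn_einf v <= c)%E.
Proof.
move=> vc; apply: le_trans (limn_einf_sup v) _.
rewrite /limn_esup limf_esupE; apply: le_trans (ereal_inf_lbound _) _.
  by exists setT; [exact: filterT|reflexivity].
by apply: ge_ereal_sup => _ [n _ <-].
Qed.

Lemma measurable_fun_limn_einf (D : set R) (v : nat -> R -> \bar R) :
  (forall n, measurable_fun D (v n)) ->
  measurable_fun D (fun x => limn_einf (v ^~ x)).
Proof.
move=> mv.
have -> : (fun x => limn_einf (v ^~ x)) =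
    (fun x => - limn_esup (fun n => - v n x))%E.
  by apply/funext => x; rewrite -limn_einfN; congr limn_einf; apply/funext => n /=; rewrite oppeK.
apply: measurableT_comp => //; apply: measurable_fun_limn_esup => n.
exact: measurableT_comp.
Qed.

Let clamp (a b t : R) := Num.max a (Num.min t b).

(** Half of the fundamental theorem of calculus survives for a monotone
    function, by Fatou's lemma for its difference quotients: its singular part
    can only add to the increment. *)
Lemma ge0_integral_le_increment (F h : R -> R) (a b : R) : a <= b ->
  {in `[a, b] &, nondecreasing F} ->
  measurable_fun setT h -> (forall x, 0 <= h x) ->
  {ae mu, forall t, a < t < b -> exists2 l : R, is_derive t (1 : R) F l & h t <= l} ->
  (\int[mu]_(x in `]a, b]) (h x)%:E <= (F b - F a)%:E)%E.
Proof.
move=> ab ndF mh h0 hF.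
have cab t : clamp a b t \in `[a, b].
  by rewrite in_itv/= /clamp le_max lexx/= ge_max ab/= ge_min lexx orbT.
have cle s t : s <= t -> clamp a b s <= clamp a b t.
  move=> st; rewrite /clamp ge_max le_max lexx/= le_max le_min !ge_min st lexx/=.
  by rewrite !orbT.
pose G (t : R) := F (clamp a b t) - F a.
have ndG : nondecreasing G by move=> s t st; rewrite lerD2r ndF// cle.
have ca : clamp a b a = a by rewrite /clamp min_l// maxxx.
have cb t : b <= t -> clamp a b t = b by move=> bt; rewrite /clamp min_r// max_r.
have aab : a \in `[a, b] by rewrite in_itv/= lexx.
have G0 t : 0 <= G t.
  by rewrite subr_ge0 ndF//; have := cab t; rewrite in_itv/= => /andP[].
have Gb t : G t <= F b - F a.
  rewrite lerD2r ndF// ?in_itv/= ?ab ?lexx//.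
  by have := cab t; rewrite in_itv/= => /andP[].
have mG : measurable_fun setT G by exact: nondecreasing_measurable.
have mGe (e : R) : measurable_fun setT (fun t : R => G (t + e)).
  by apply: nondecreasing_measurable => // s t st; rewrite ndG// lerD2r.
pose e (n : nat) : R := n.+1%:R^-1.
have e0 n : 0 < e n by rewrite invr_gt0.
pose d n (t : R) := (G (t + e n) - G t) / e n.
have d0 n t : 0 <= d n t.
  by rewrite divr_ge0 ?(ltW (e0 n))// subr_ge0 ndG// lerDl ltW.
have md n : measurable_fun setT (d n).
  by apply: measurable_funM => //; apply: measurable_funB.
have ibnd (g : R -> R) (x y : R) : measurable_fun setT g -> (forall t : R, 0 <= g t) ->
    (forall t : R, g t <= F b - F a) -> mu.-integrable `]x, y] (EFin \o g).
  move=> mg g0 gb; apply: measurable_bounded_integrable => //.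
  - exact: mu_itv_lty.
  - exact: measurable_funTS.
  exists (F b - F a); split; first by rewrite num_real.
  by move=> M bM t _ /=; rewrite ger0_norm// (le_trans (gb _))// ltW.
have intd n : (\int[mu]_(x in `]a, b]) (d n x)%:E <= (F b - F a)%:E)%E.
  have iG x y : mu.-integrable `]x, y] (EFin \o G) by apply: ibnd.
  have iGe x y : mu.-integrable `]x, y] (EFin \o (fun t : R => G (t + e n))).
    by apply: ibnd.
  have step : (\int[mu]_(x in `]a, b]) (G (x + e n)%R)%:E <=
      \int[mu]_(x in `]a, b]) (G x)%:E + ((F b - F a) * e n)%:E)%E.
    rewrite ge0_integral_shift//.
    apply: (@le_trans _ _ (\int[mu]_(x in `]a, (b + e n)%R]) (G x)%:E)%E).
      apply: ge0_subset_integral => //.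
      - by apply: measurable_funTS; apply/measurable_EFinP.
      - by move=> x _; rewrite lee_fin.
      - by move=> x /=; rewrite !in_itv/= => /andP[ax ->]; rewrite (le_lt_trans _ ax)// lerDl ltW.
    have bbe : b <= b + e n by rewrite lerDl ltW.
    rewrite (@itv_bndbnd_setU _ _ _ (BRight b)) ?bnd_simp//.
    rewrite ge0_integral_setU//=.
    - apply: leeD => //.
      apply: (@le_trans _ _ (\int[mu]_(x in `]b, (b + e n)%R]) (cst (F b - F a)%:E x))%E).
        apply: ge0_le_integral => //.
        - by move=> x _; rewrite lee_fin.
        - by apply: measurable_funTS; apply/measurable_EFinP.
        - by move=> x _; rewrite lee_fin.
      have muE : mu `]b, b + e n]%classic = (e n)%:E.
        by rewrite lebesgue_measure_itv/= lte_fin ltrDl e0 -EFinB addrAC subrr add0r.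
      by rewrite integral_cst// [X in (_ * X)%E]muE.
    - by apply: measurable_funTS; apply/measurable_EFinP.
    - by move=> x _; rewrite lee_fin.
    - apply/disj_setPS => y [/=]; rewrite !in_itv/= => /andP[_ yb] /andP[].
      by rewrite ltNge yb.
  have -> : (\int[mu]_(x in `]a, b]) (d n x)%:E =
      (\int[mu]_(x in `]a, b]) (G (x + e n)%R)%:E - \int[mu]_(x in `]a, b]) (G x)%:E)
        * ((e n)^-1)%:E)%E.
    rewrite -integralB_EFin// -integralZr//; last exact: integrableB.
  rewrite -lee_pdivlMr ?invr_gt0//.
  rewrite invrK leeBlDr; last by apply: integrable_fin_num.
  by rewrite addeC -EFinM.
have fat : (\int[mu]_(x in `]a, b]) limn_einf (fun n => (d n x)%:E) <= (F b - F a)%:E)%E.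
  apply: (le_trans (fatou _ _ _ _)) => //.
  - by move=> n; apply: measurable_funTS; apply/measurable_EFinP; exact: md.
  - by move=> n x _; rewrite lee_fin.
  exact: limn_einf_le.
apply: le_trans fat.
rewrite -!integral_itv_bndo_bndc; last 2 first.
- by apply: measurable_fun_limn_einf => n; apply: measurable_funTS; apply/measurable_EFinP; exact: md.
- by apply: measurable_funTS; apply/measurable_EFinP.
apply: ae_ge0_le_integral => //.
- by move=> x _; rewrite lee_fin.
- by apply: measurable_funTS; apply/measurable_EFinP.
- move=> x _; rewrite limn_einf_lim; apply: lime_ge; first exact: is_cvg_einfs.
  by apply: nearW => n; apply: le_ereal_inf_tmp => _ [k _ <-]; rewrite lee_fin.
- by apply: measurable_fun_limn_einf => n; apply: measurable_funTS; apply/measurable_EFinP; exact: md.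
apply: aeS hF => t hQ; rewrite /= in_itv/= => tab.
have [l dl hl] := hQ tab.
have cte : t + e n @[n --> \oo] --> t^'.
  have : t + e n @[n --> \oo] --> t.
    rewrite -[X in _ --> X]addr0; apply: cvgD; first exact: cvg_cst.
    exact: cvg_harmonic.
  move=> c A nA.
  have hA : \forall n \near \oo, t + e n != t -> A (t + e n) := c _ nA.
  suff : \forall n \near \oo, A (t + e n) by [].
  apply: filterS hA => n; apply.
  by have h' : t < t + e n; [rewrite ltrDl|rewrite (gt_eqF h')].
have : (d n t)%:E @[n --> \oo] --> l%:E.
  apply/fine_cvgP; split; first exact: nearW.
  have := cvg_comp _ _ cte (is_derive_cvg_quotient dl).
  apply: cvg_trans; apply: near_eq_cvg.
  have nt : \forall s \near t^', s \in `]a, b[.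
    by apply: cvg_within; apply: near_in_itvoo; rewrite in_itv.
  have cid s : s \in `]a, b[ -> clamp a b s = s.
    by rewrite in_itv/= => /andP[sa sb]; rewrite /clamp min_l ?max_r ?ltW.
  have nab : \forall n \near \oo, t + e n \in `]a, b[ := cte _ nt.
  apply: filterS nab => n nab; rewrite /d /G /= (cid _ nab) cid ?in_itv//=.
  by rewrite opprB addrA subrK (addrC t) addrK.
move=> c; have cv : cvgn (fun n => (d n t)%:E) by apply/cvg_ex; exists l%:E.
by rewrite is_cvg_limn_einfE// (cvg_lim _ c)// lee_fin.
Qed.

End monotone_derivative.

Section time_change.
Context {R : realType}.
Local Notation mu := (@lebesgue_measure R).
Variables (w F tm : R -> R) (a b : R).
(* [tmF] says that [tm] inverts the primitive [F], in the form which computes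
   the preimages of intervals *)
Hypotheses (ab : a <= b) (w0 : forall x, 0 <= w x)
  (iw : mu.-integrable `]a, b] (EFin \o w))
  (Fw : forall x, a <= x <= b -> (F x - F a = \int[mu]_(r in `]a, x]) w r)%R)
  (tmF : forall s x, F a < s <= F b -> a <= x <= b -> (tm s <= x) = (s <= F x)).

Let iwS (c d : R) : a <= c -> d <= b -> mu.-integrable `]c, d] (EFin \o w).
Proof.
move=> ac db; apply: integrableS iw => // x /=; rewrite !in_itv/=.
by move=> /andP[cx xd]; rewrite (le_lt_trans ac cx) (le_trans xd db).
Qed.

Let Fincr (c d : R) : a <= c -> c <= d -> d <= b ->
  (F d - F c = \int[mu]_(r in `]c, d]) w r)%R.
Proof.
move=> ac cd db; rewrite -(@Rintegral_itvB _ _ (BRight a)) ?bnd_simp//; last exact: iwS.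
by rewrite -!Fw ?ac ?(le_trans ac cd) ?(le_trans cd db)//; lra.
Qed.

Let Fle (c d : R) : a <= c -> c <= d -> d <= b -> F c <= F d.
Proof. by move=> ac cd db; rewrite -subr_ge0 Fincr//; exact: Rintegral_ge0. Qed.

Let tm_itv s : F a < s <= F b -> a < tm s <= b.
Proof.
move=> /[dup] sF /andP[Fas sFb].
by rewrite ltNge !tmF// ?ab ?lexx// -ltNge Fas sFb.
Qed.

(* [tm] is prolonged by values outside of ]a, b], so that the preimage of
   this interval is exactly ]F a, F b] *)
Let tmx s := if s <= F a then a else if s <= F b then tm s else b + 1.

Let tmx_nd : nondecreasing tmx.
Proof.
move=> s t st; rewrite /tmx.
have [tFa|Fat] := leP t (F a); first by rewrite (le_trans st tFa).
have [sFa|Fas] := leP s (F a).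
  have [tFb|Fbt] := leP t (F b); last by have := ab; lra.
  by have /andP[/ltW] : a < tm t <= b by apply: tm_itv; rewrite Fat.
have [tFb|Fbt] := leP t (F b).
  have /andP[/ltW atm tmb] : a < tm t <= b by apply: tm_itv; rewrite Fat.
  rewrite (le_trans st tFb) tmF ?Fas ?(le_trans st tFb) ?atm//.
  by rewrite (le_trans st)// -tmF ?lexx ?Fat ?atm.
have [sFb|//] := leP s (F b).
have /andP[_] : a < tm s <= b by apply: tm_itv; rewrite Fas.
lra.
Qed.

Let mtmx : measurable_fun setT (tmx : measurableTypeR R -> measurableTypeR R).
Proof. exact: (@nondecreasing_measurable R). Qed.

Let tmx_preimage (c d : R) : a <= c -> c <= d -> d <= b ->
  tmx @^-1` `]c, d] = `]F c, F d]%classic.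
Proof.
move=> ac cd db; apply/seteqP; split => s /=; rewrite !in_itv/= /tmx.
  have [sFa|Fas] := leP s (F a); first by rewrite ltNge ac.
  have [sFb|Fbs] := leP s (F b); last by move=> /andP[_]; lra.
  by rewrite ltNge !tmF ?Fas ?ac ?db ?(le_trans cd db) ?(le_trans ac cd)// -ltNge.
move=> /andP[Fcs sFd].
have Fas : F a < s by apply: le_lt_trans Fcs; apply: Fle => //; exact: le_trans cd db.
have sFb : s <= F b by apply: le_trans sFd _; apply: Fle => //; exact: le_trans ac cd.
rewrite leNgt Fas/= sFb ltNge !tmF ?Fas ?ac ?db ?(le_trans cd db) ?(le_trans ac cd)//.
by rewrite -ltNge Fcs.
Qed.

Let wab : R -> R := w \_ `]a, b].

Let wab0 x : 0 <= wab x. Proof. by rewrite /wab patchE; case: ifP. Qed.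

Let iwab : mu.-integrable setT (EFin \o wab).
Proof.
rewrite /wab -restrict_EFin.
have mJ : measurable (`]a, b]%classic : set (measurableTypeR R)) by exact: measurable_itv.
exact: ((@integrable_mkcond _ _ _ mu _ _ mJ).1 iw).
Qed.

Let pf : {measure set (measurableTypeR R) -> \bar R} :=
  measure_function_pushforward__canonical__measure_function_Measure mu mtmx.

Let mab : measurable (`]a, b]%classic : set (measurableTypeR R)).
Proof. exact: measurable_itv. Qed.

Let pfE A : measurable A -> A `<=` `]a, b] -> pf A = density_measure wab0 iwab A.
Proof.
move=> mA Aab; transitivity (mrestr pf mab A).
  by rewrite /mrestr setIidl.
have mrE c d : mrestr pf mab `]c, d]%classic =
    (\int[mu]_(x in `]c, d]) (wab x)%:E)%E.
  rewrite /mrestr.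
  have -> : (fun x => (wab x)%:E) = ((EFin \o w) \_ `]a, b]).
    by apply/funext => x; rewrite /wab !patchE /=; case: ifP.
  rewrite -integral_mkcondr.
  have -> : `]c, d]%classic `&` `]a, b]%classic =
      `](Num.max a c), (Num.min b d)]%classic :> set R.
    apply/seteqP; split => x /=; rewrite !in_itv/= gt_max le_min.
      by move=> [/andP[-> ->] /andP[-> ->]].
    by move=> /andP[/andP[-> ->] /andP[-> ->]].
  have [cd|dc] := leP (Num.max a c) (Num.min b d); last first.
    by rewrite set_itv_ge ?measure0 ?integral_set0// bnd_simp -leNgt ltW.
  have ac : a <= Num.max a c by rewrite le_max lexx.
  have db : Num.min b d <= b by rewrite ge_min lexx.
  rewrite /pf /= /pushforward tmx_preimage//.
  transitivity (F (Num.min b d) - F (Num.max a c))%:E.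
    rewrite lebesgue_measure_itv/= lte_fin; case: ltP => [_|]; first by rewrite EFinB.
    by have := Fle ac cd db; move=> h1 h2; congr EFin; lra.
  by rewrite Fincr// /Rintegral fineK//; apply: integrable_fin_num => //; exact: iwS.
apply: eq_measure_ocitv => // c d; rewrite /= ?mrE// -ge0_fin_numE.
  by apply: integrable_fin_num => //; apply: integrableS iwab.
by apply: integral_ge0 => x _; rewrite lee_fin.
Qed.

(** The image of Lebesgue measure under the inverse of a primitive of [w] has
    density [w]. *)
Lemma ge0_integral_time_change (f : R -> R) :
  measurable_fun setT f -> (forall x, 0 <= f x) ->
  (\int[mu]_(s in `]F a, F b]) (f (tm s))%:E =
   \int[mu]_(t in `]a, b]) (f t * w t)%:E)%E.
Proof.
move=> mf f0.
transitivity (\int[mu]_(s in tmx @^-1` `]a, b]) ((EFin \o f) \o tmx) s)%E.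
  rewrite tmx_preimage ?lexx//; apply: eq_integral => s; rewrite inE/= in_itv/=.
  by move=> /andP[Fas sFb]; rewrite /= /tmx leNgt Fas/= sFb.
have mfab : measurable_fun (`]a, b]%classic : set (measurableTypeR R)) (EFin \o f).
  by apply: measurable_funTS; apply/measurable_EFinP.
rewrite -(ge0_integral_pushforward mtmx)//; last by move=> x _; rewrite lee_fin.
transitivity (\int[density_measure wab0 iwab]_(x in `]a, b]) (f x)%:E)%E.
  by apply: eq_measure_integral => A mA Aab; exact: pfE.
rewrite ge0_integral_density//.
- apply: eq_integral => x xab; rewrite EFinM; congr (_ * _%:E)%E.
  by rewrite /wab patchE xab.
- exact/measurable_EFinP.
Qed.

(** Consequently an absolutely continuous change of time does not see null
    sets. *)
Lemma time_change_null (N : set R) : measurable N -> mu N = 0%E ->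
  mu.-negligible [set s | F a < s <= F b /\ N (tm s)].
Proof.
move=> mN N0.
exists (tmx @^-1` (N `&` `]a, b])); split.
- rewrite -[X in measurable X]setTI; apply: mtmx => //.
  by apply: measurableI => //; exact: measurable_itv.
- transitivity (density_measure wab0 iwab (N `&` `]a, b]%classic)).
    by rewrite -pfE//; apply: measurableI => //; exact: measurable_itv.
  have /null_content_dominatesP := density_measure_dominates wab0 iwab; apply.
    by apply: measurableI => //; exact: measurable_itv.
  by apply: (subset_measure0 _ _ _ N0) => //; apply: measurableI => //; exact: measurable_itv.
- move=> s /= [/[dup] sF /andP[Fas sFb] Ns].
  rewrite /tmx leNgt Fas/= sFb; split => //=.
  by rewrite in_itv/=; exact: tm_itv.
Qed.

End time_change.

(** * Equality in Young's inequality and nonmeasurable integrands *)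

Section conjugate_exponents.
Context {R : realType}.
Variable p : R.
Hypothesis p1 : 1 < p.
Local Notation q := (conj_exp p).

Lemma conj_exp_gt1 : 1 < q.
Proof.
have p0 : 0 < p by rewrite (lt_trans _ p1).
rewrite /conj_exp invf_gt1 ?subr_gt0 ?invf_lt1//.
by rewrite ltrBlDr ltrDl invr_gt0.
Qed.

Lemma conj_expE : q = p / (p - 1).
Proof.
have p0 : p != 0 by rewrite gt_eqF// (lt_trans _ p1).
have -> : conj_exp p = ((p - 1) / p)^-1 by rewrite mulrBl divff// mul1r.
by rewrite invf_div.
Qed.

Lemma mul_conj_exp : (p - 1) * q = p.
Proof. by rewrite conj_expE mulrC divfK// subr_eq0 gt_eqF. Qed.

Lemma conj_expB1 : (q - 1) * (p - 1) = 1.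
Proof. by rewrite mulrBl mul1r mulrC mul_conj_exp; lra. Qed.

(** Equality in Young's inequality: as a function of [g] the gap
    [x^p / p + g^q / q - x g] is minimal where its derivative vanishes. *)
Lemma young_equality (x g l : R) : 0 <= x -> 0 <= g ->
  l <= - (p^-1 * x `^ p) - q^-1 * g `^ q -> - l <= g * x ->
  l = - x `^ p /\ g = x `^ (p - 1).
Proof.
move=> x0 g0 h1 h2.
have p0 : 0 < p by rewrite (lt_trans _ p1).
have q0 : 0 < q by rewrite (lt_trans _ conj_exp_gt1).
have young (y : R) : 0 <= y -> x * y <= p^-1 * x `^ p + q^-1 * y `^ q.
  by move=> y0; rewrite ![_^-1 * _]mulrC; exact: conjugate_powR (conj_expP p).
have eqg : x * g = p^-1 * x `^ p + q^-1 * g `^ q.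
  by apply/eqP; rewrite eq_le young//=; move: h1 h2; rewrite (mulrC g); lra.
have lE : l = - (x * g) by move: h1 h2; rewrite (mulrC g); lra.
suff gE : g = x `^ (p - 1).
  split => //; rewrite lE gE -(@mulr_powRB1 _ x p)//.
have [x00|x00] := eqVneq x 0.
  move: eqg; rewrite x00 mul0r powR0 ?gt_eqF// mulr0 add0r => /esym/eqP.
  rewrite mulf_eq0 invr_eq0 gt_eqF//= powR_eq0 => /andP[/eqP -> _].
  by rewrite powR0// subr_eq0 gt_eqF.
have {}x0 : 0 < x by rewrite lt_neqAle eq_sym x00.
have {}g0 : 0 < g.
  rewrite lt_neqAle eq_sym g0 andbT; apply/eqP => g00; move: eqg.
  rewrite g00 mulr0 powR0 ?gt_eqF// mulr0 addr0 => /esym/eqP.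
  by rewrite mulf_eq0 invr_eq0 gt_eqF//= powR_eq0 (negbTE x00).
pose H (y : R) := q^-1 * y `^ q - x * y.
have dpow (y : R) : y \in `]0, 2 * g[ -> is_derive y (1 : R) (@powR R ^~ q) (q * y `^ (q - 1)).
  rewrite in_itv/= => /andP[y0 _].
  have yo : y \in `]0, +oo[ by rewrite in_itv/= y0.
  rewrite -powR_derive1// derive1E; apply: derivableP.
  exact: derivable_powR.
have dH (y : R) : y \in `]0, 2 * g[ -> is_derive y (1 : R) H (y `^ (q - 1) - x).
  move=> /dpow dy; rewrite /H.
  have -> : y `^ (q - 1) - x = q^-1 *: (q * y `^ (q - 1)) - x *: 1.
    by rewrite /GRing.scale/= mulrA mulVf ?mul1r ?mulr1// gt_eqF.
  by apply: is_deriveB.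
have gg : g \in `]0, 2 * g[ by rewrite in_itv/= g0/=; lra.
have d0 : is_derive g (1 : R) H 0.
  apply: (@derive1_at_min _ H 0 (2 * g)) => //; first lra.
    by move=> y /dH[].
  move=> y; rewrite in_itv/= => /andP[y0 _]; rewrite /H.
  by have := young _ (ltW y0); move: eqg; lra.
have /eqP : g `^ (q - 1) - x = 0.
  by have [_ <-] := dH _ gg; have [_ ->] := d0.
rewrite subr_eq0 => /eqP <-.
by rewrite -powRrM conj_expB1 powRr1// ltW.
Qed.

End conjugate_exponents.

Section ae_integral.
Context d (T : measurableType d) (R : realType).
Variable mu : {measure set T -> \bar R}.
Implicit Types D : set T.
Local Open Scope ereal_scope.

Lemma ge0_le_integral_nomeas D (f g : T -> \bar R) :
  (forall x, D x -> 0 <= f x) -> (forall x, D x -> f x <= g x) ->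
  \int[mu]_(x in D) f x <= \int[mu]_(x in D) g x.
Proof.
move=> f0 fg; rewrite !ge0_integralE//; last first.
  by move=> x Dx; rewrite (le_trans (f0 _ Dx)) ?fg.
apply: le_ereal_sup => _ [h /= hf <-]; exists h => //= x.
apply: le_trans (hf x) _; rewrite !patchE; case: ifPn => // xD.
by apply: fg; rewrite inE in xD.
Qed.

(** The integral is a supremum over simple functions, so a nonmeasurable
    integrand may be replaced by a measurable one it equals almost
    everywhere. *)
Lemma ge0_ae_eq_integral_nomeas D (f g : T -> \bar R) : measurable D ->
  (forall x, D x -> 0 <= f x) -> (forall x, D x -> 0 <= g x) ->
  measurable_fun D g -> {ae mu, forall x, D x -> f x = g x} ->
  \int[mu]_(x in D) f x = \int[mu]_(x in D) g x.
Proof.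
move=> mD f0 g0 mg [N [mN N0 fgN]].
have fgE x : D x -> ~ N x -> f x = g x.
  by move=> Dx Nx; apply: contrapT => fgx; apply: Nx; apply: fgN => /= /(_ Dx).
have mDN : measurable (D `\` N) by exact: measurableD.
have DND : D `\` N `<=` D by move=> x [].
apply/eqP; rewrite eq_le; apply/andP; split.
  pose h x := if x \in N then +oo else g x.
  have mh : measurable_fun D h.
    apply: measurable_fun_if => //.
    - by apply: (@measurable_fun_bool _ _ _ _ true); rewrite preimage_mem_true; exact: measurableI.
    - apply: measurable_funS mg => //; exact: subIsetl.
  apply: (@le_trans _ _ (\int[mu]_(x in D) h x)).
    apply: ge0_le_integral_nomeas => // x Dx; rewrite /h; case: ifPn; rewrite ?leey// => xN.
    by rewrite fgE//; move/negP : xN; rewrite inE.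
  rewrite le_eqVlt; apply/orP; left; apply/eqP.
  apply: ge0_ae_eq_integral => //.
    by move=> x Dx; rewrite /h; case: ifP; rewrite ?le0y// g0.
  exists N; split => // x /= hx; apply: contrapT => Nx; apply: hx => Dx.
  by rewrite /h memNset.
have -> : \int[mu]_(x in D) g x = \int[mu]_(x in D `\` N) g x.
  by apply: ge0_negligible_integral.
have -> : \int[mu]_(x in D `\` N) g x = \int[mu]_(x in D `\` N) f x.
  by apply: eq_integral => x; rewrite inE => -[Dx Nx]; rewrite fgE.
rewrite integral_mkcond [leRHS]integral_mkcond; apply: ge0_le_integral_nomeas => x _.
  by apply: erestrict_ge0 => y [Dy _]; exact: f0.
rewrite !patchE; have [|_] := boolP (x \in D `\` N).
  by rewrite inE => -[Dx _]; rewrite mem_set.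
by case: ifPn => //; rewrite inE; exact: f0.
Qed.

End ae_integral.

(** * Identities along a curve of maximal slope *)

Section maximal_speed.
Context {R : realType} {S : completeMetricType R}.
Local Notation mu := (@lebesgue_measure R).
Variable f : S -> \bar R.
Hypothesis f_gtNy : forall v, (-oo < f v)%E.

(** A measurable representative [m] of the metric derivative, together with
    the two identities [(f o u)' = - m^p] and [|df|(u) = m^(p - 1)] to which the
    inequality defining curves of maximal slope amounts. *)
Definition maximal_speed (p : R) (u : R -> S) (m : R -> R) : Prop :=
  [/\ measurable_fun setT m, (forall t, 0 <= m t),
      (forall T : R, mu.-integrable `[0, T] (EFin \o m)),
      (forall s t, 0 <= s -> s <= t ->
         mdist (u s) (u t) <= (\int[mu]_(r in `]s, t]) m r)%R) &
      {ae mu, forall t, 0 < t ->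
         [/\ mdist (u t) (u s) / `|t - s| @[s --> t^'] --> m t,
             is_derive t (1 : R) (fine \o f \o u : R -> R) (- (m t `^ p)) &
             local_slope f (u t) = (m t `^ (p - 1))%:E]}].

Lemma metric_derivativeE (u : R -> S) (t x : R) :
  mdist (u t) (u s) / `|t - s| @[s --> t^'] --> x -> metric_derivative u t = x.
Proof. by move=> h; apply/cvg_lim. Qed.

Lemma ae_neq (r : R) : {ae mu, forall t : R, t != r}.
Proof.
exists [set r]; split; first exact: measurable_set1.
  exact: lebesgue_measure_set1.
by move=> t /= /negP; rewrite negbK => /eqP.
Qed.

(** With [m^p] in place of both powers, the right-hand side of the defining
    inequality is [- (1/p + 1/q) m^p]. *)
Lemma maximal_speed_CMS (p : R) u m u0 : 1 < p -> maximal_speed p u m ->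
  (forall s t, 0 <= s -> s <= t -> (f (u t) <= f (u s))%E) -> u 0 = u0 ->
  CMS f p +oo%E u0 u.
Proof.
move=> p1 [mm m0 im um aem] nonincr uu0; split => //.
- exists m; split.
    move=> K cK K0.
    have [M [Mr hM]] := compact_bounded cK.
    apply: integrableS (im (`|M| + 1)) => //; first exact: compact_measurable.
    move=> x Kx /=; rewrite in_itv/=; have /= [-> _] := K0 _ Kx.
    by rewrite (le_trans (ler_norm _))// hM// ltr_pwDr// ler_norm.
  move=> s t [s0 _] _ st.
  have mS (D : set R) : measurable_fun D (EFin \o m).
    by apply: measurable_funTS; apply/measurable_EFinP.
  rewrite -integral_itv_obnd_cbnd; last exact: mS.
  rewrite -[leRHS]fineK; first by rewrite lee_fin um.
  apply: integrable_fin_num => //; apply: integrableS (im t) => //.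
  by move=> x /=; rewrite !in_itv/= => /andP[sx ->]; rewrite (le_trans s0)// ltW.
- by move=> s t [s0 _] _ st; exact: nonincr.
apply: aeS2 (ae_neq 0) aem => t t00 + [t0 _].
have {t00}t0 : 0 < t by rewrite lt_neqAle eq_sym t00.
move=> /(_ t0)[qt [dt dtE] ->]; split; first exact: dt.
rewrite (metric_derivativeE qt) derive1E dtE poweR_EFin -EFinM -EFinN -EFinB lee_fin.
rewrite -powRrM mul_conj_exp// (_ : (conj_exp p)^-1 = 1 - p^-1); last first.
  by rewrite -(conj_expP p) addrAC subrr add0r.
by rewrite mulrBl; lra.
Qed.

Section convex.
Variables (p0 lambda : R).
Hypotheses (lambda_lt0 : lambda < 0) (p0_ge2 : 2 <= p0)
  (f_convex : pl_convex f p0 lambda).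

(** In [slope_upper] the term in [d^p0] is at most of order [d^2], because
    [p0 >= 2]; divided by the elapsed time it vanishes in the limit. *)
Lemma derive_le_slope_speed (u : R -> S) (t g x l : R) :
  (\forall s \near t, (f (u s) < +oo)%E) ->
  mdist (u t) (u s) / `|t - s| @[s --> t^'] --> x ->
  is_derive t (1 : R) (fine \o f \o u : R -> R) l ->
  (local_slope f (u t) <= g%:E)%E -> - l <= g * x.
Proof.
move=> fu qt dl gt.
have p00 : 0 < p0 by have := p0_ge2; lra.
set Q := fun s => mdist (u t) (u s) / `|t - s| in qt.
have cl := is_derive_cvg_quotient dl.
have cts : `|t - s| @[s --> t^'] --> (0 : R).
  have : `|t - s| @[s --> t] --> `|t - t|.
    by apply: cvg_norm; apply: cvgB; [exact: cvg_cst|exact: cvg_id].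
  by rewrite subrr normr0; exact: cvg_within_filter.
have cd : mdist (u t) (u s) @[s --> t^'] --> (0 : R).
  rewrite -(mulr0 x); apply: cvg_trans (cvgM qt cts).
  apply: near_eq_cvg; near=> s; rewrite /Q /= divfK// normr_eq0 subr_eq0 eq_sym.
  by near: s; exact: nbhs_dnbhs_neq.
have {}cl := cvgN (cvg_dnbhs_at_right cl).
have cr : (g + - lambda * mdist (u t) (u s)) * Q s @[s --> t^'+] --> g * x.
  apply: cvg_dnbhs_at_right; apply: cvgM qt.
  rewrite -[X in _ --> X]addr0 -(mulr0 (- lambda)).
  by apply: cvgD; [exact: cvg_cst|apply: cvgM cd; exact: cvg_cst].
apply: (ler_cvg_to (cl _) cr); near=> s.
have ts : t < s by near: s; exact: nbhs_right_gt.
have fus : (f (u s) < +oo)%E by near: s; exact: cvg_within fu.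
have fut : (f (u t) < +oo)%E by exact: nbhs_singleton fu.
have d1 : mdist (u t) (u s) < 1.
  near: s; have /cvgrPdist_lt/(_ 1 ltr01) := cvg_dnbhs_at_right cd.
  apply: filterS => s; rewrite sub0r normrN; apply: le_lt_trans; exact: ler_norm.
set d := mdist (u t) (u s) in d1 *.
have d0 : 0 <= d by exact: mdist_ge0.
have := slope_upper f_gtNy lambda_lt0 p00 f_convex fut fus gt; rewrite -/d => h.
have dp : d `^ p0 <= d * d.
  have [->|dn0] := eqVneq d 0; first by rewrite powR0 ?mulr0// gt_eqF.
  have dd : 0 < d <= 1 by rewrite lt_neqAle eq_sym dn0 d0/= ltW.
  rewrite -expr2 -(powR_mulrn 2 d0).
  exact: ger_powR.
have {}h : fine (f (u t)) - fine (f (u s)) <= (g + - lambda * d) * d.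
  apply: le_trans h _; rewrite mulrDl lerD2l -mulrA ler_wpM2l// oppr_ge0 ltW//.
rewrite /Q /= -/d -mulNr opprB distrC ger0_norm ?subr_ge0 ?(ltW ts)// mulrA.
by rewrite ler_wpM2r// invr_ge0 subr_ge0 ltW.
Unshelve. all: by end_near. Qed.

Lemma CMS_fin (p : R) u u0 t : (f u0 < +oo)%E -> CMS f p +oo%E u0 u -> 0 <= t ->
  (f (u t) < +oo)%E.
Proof.
move=> fu0 [_ uu0 nonincr _] t0; apply: le_lt_trans fu0; rewrite -uu0.
by apply: nonincr => //; split; rewrite ?ltry.
Qed.

(** The defining inequality and [derive_le_slope_speed] bound the derivative
    of [f o u] from both sides, which is the equality case of Young's
    inequality. *)
Lemma CMS_maximal_speed (p : R) u u0 : 1 < p -> (f u0 < +oo)%E ->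
  CMS f p +oo%E u0 u -> exists m, maximal_speed p u m.
Proof.
move=> p1 fu0 cms; have [acu uu0 nonincr aeu] := cms.
have [m [mm m0 im um lm]] := ACloc_speed acu.
exists m; split => //.
apply: aeS2 aeu lm => t hu hm t0.
have [du +] := hu (conj (ltW t0) (ltry _)).
have qt := hm t0; rewrite (metric_derivativeE qt).
have q1 := conj_exp_gt1 p1; have q0 : 0 < conj_exp p by lra.
have := local_slope_ge0 f (u t).
case gE : (local_slope f (u t)) => [g| |//]; last first.
  have qi0 : (0 < ((conj_exp p)^-1)%:E)%E by rewrite lte_fin invr_gt0.
  by rewrite poweRyr ?gt_eqF// gt0_muley//= addeNy leeNy_eq.
rewrite lee_fin poweR_EFin -EFinM -EFinN -EFinB lee_fin => g0 h1.
have dl : is_derive t (1 : R) (fine \o f \o u : R -> R)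
    (derive1 (fine \o f \o u : R -> R) t).
  by rewrite derive1E; apply: derivableP.
have h2 : - derive1 (fine \o f \o u : R -> R) t <= g * m t.
  apply: derive_le_slope_speed qt dl _; last by rewrite gE.
  have : \forall s \near t, 0 < s by exact: lt_nbhsr.
  by apply: filterS => s s0; apply: CMS_fin cms _ => //; exact: ltW.
have [lE gE'] := young_equality p1 (m0 t) g0 h1 h2.
by rewrite -gE'; split => //; rewrite -lE.
Qed.

End convex.
End maximal_speed.

(** * Energy, and rest at points of zero slope *)

Section maximal_slope_curve.
Context {R : realType} {S : completeMetricType R}.
Local Notation mu := (@lebesgue_measure R).
Variables (f : S -> \bar R) (p : R) (u : R -> S) (m : R -> R).
Hypotheses (f_gtNy : forall v, (-oo < f v)%E) (p1 : 1 < p)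
  (um : maximal_speed f p u m) (fu : forall t, 0 <= t -> (f (u t) < +oo)%E)
  (nonincr : forall s t, 0 <= s -> s <= t -> (f (u t) <= f (u s))%E).

Let phi t := fine (f (u t)).

Let mm : measurable_fun setT m. Proof. by case: um. Qed.
Let m0 t : 0 <= m t. Proof. by case: um. Qed.

Lemma speed_measurable_EFin (D : set R) : measurable_fun D (EFin \o m).
Proof. by apply: measurable_funTS; apply/measurable_EFinP. Qed.

Lemma speed_integrable (s t : R) : 0 <= s -> mu.-integrable `]s, t] (EFin \o m).
Proof.
move=> s0; have [_ _ im _ _] := um; apply: integrableS (im t) => //.
by move=> x /=; rewrite !in_itv/= => /andP[sx ->]; rewrite (le_trans s0)// ltW.
Qed.

Lemma phi_nonincr (s t : R) : 0 <= s -> s <= t -> phi t <= phi s.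
Proof.
move=> s0 st; rewrite /phi fine_le ?fin_numf ?fu ?nonincr//.
exact: le_trans st.
Qed.

(** Dissipation of the functional controls the [p]-energy of the curve. *)
Lemma energy_inequality (a b : R) : 0 <= a -> a <= b ->
  (\int[mu]_(r in `]a, b]) (m r `^ p)%:E <= (phi a - phi b)%:E)%E.
Proof.
move=> a0 ab.
have -> : phi a - phi b = (- phi b) - (- phi a) by lra.
apply: (@ge0_integral_le_increment _ (fun t => - phi t) (fun t => m t `^ p)) => //.
- move=> s t; rewrite !in_itv/= => /andP[sa _] _ st.
  by rewrite lerN2 phi_nonincr// (le_trans a0).
- exact: (measurableT_comp (measurable_powR p)).
- by move=> x; exact: powR_ge0.
have [_ _ _ _ aem] := um; apply: aeS aem => t h /andP[at_ _].
have [_ dphi _] := h (le_lt_trans a0 at_).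
exists (m t `^ p) => //; rewrite -[m t `^ p]opprK.
exact: is_deriveN.
Qed.

Lemma curve_near (T e : R) : 0 <= T -> 0 < e ->
  \forall s \near T, 0 <= s -> mdist (u s) (u T) < e.
Proof.
move=> T0 e0; have [_ _ im umd _] := um.
have T10 : 0 <= T + 1 by lra.
have := parameterized_integral_continuous T10 (im (T + 1)).
move=> /subspace_continuousP /(_ T).
rewrite /= in_itv/= T0 lerDl ler01 => /(_ isT) /cvgrPdist_lt /(_ _ e0).
move=> h.
have h2 : \forall s \near T, 0 <= s <= T + 1 ->
    `|parameterized_integral mu 0 T m - parameterized_integral mu 0 s m| < e.
  by move: h; rewrite near_withinE; apply: filterS => s hs sT; apply: hs; rewrite /= in_itv.
have h1 : \forall s \near T, s < T + 1 by apply: lt_nbhsl; lra.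
apply: filterS2 h2 h1 => s + s1 s0; rewrite s0 ltW// => /(_ isT).
have PE a b : 0 <= a -> a <= b -> parameterized_integral mu 0 b m -
    parameterized_integral mu 0 a m = (\int[mu]_(r in `]a, b]) m r)%R.
  by move=> a0 ab; rewrite /parameterized_integral Rintegral_itvB//= bnd_simp.
have [sT|/ltW Ts] := leP s T.
  by rewrite PE//; apply: le_lt_trans; apply: le_trans (ler_norm _); exact: umd.
rewrite distrC PE//; apply: le_lt_trans; apply: le_trans (ler_norm _).
by rewrite metric_sym; exact: umd.
Qed.

Section convex.
Variables (p0 lambda : R).
Hypotheses (lambda_lt0 : lambda < 0) (p0_ge2 : 2 <= p0) (p_le : p <= p0)
  (f_convex : pl_convex f p0 lambda) (f_lsc : lower_semicontinuous f).

(** A speed [x] is either at most [c], or at most [c^(1 - p) x^p]. *)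
Let dist_le_young (a b c : R) : 0 <= a -> a <= b -> 0 < c ->
  mdist (u a) (u b) <= c * (b - a) + c `^ (1 - p) * (phi a - phi b).
Proof.
move=> a0 ab c0; have [_ _ _ umd _] := um.
apply: (le_trans (umd _ _ a0 ab)).
rewrite -lee_fin /Rintegral fineK; last first.
  by apply: integrable_fin_num => //; exact: speed_integrable.
have mp : measurable_fun setT (fun x => m x `^ p).
  exact: (measurableT_comp (measurable_powR p)).
apply: (@le_trans _ _ (\int[mu]_(r in `]a, b]) (c%:E + (c `^ (1 - p))%:E * (m r `^ p)%:E))%E).
  apply: ge0_le_integral => //.
  - by move=> x _; rewrite lee_fin.
  - exact: speed_measurable_EFin.
  - apply: emeasurable_funD => //; apply: emeasurable_funM => //.
    by apply: measurable_funTS; apply/measurable_EFinP.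
  move=> x _; rewrite -EFinM -EFinD lee_fin.
  have [mc|/ltW cm] := leP (m x) c.
    by apply: (le_trans mc); rewrite lerDl mulr_ge0 ?powR_ge0.
  apply: (@le_trans _ _ (c `^ (1 - p) * m x `^ p)); last by rewrite lerDr ltW.
  have mx0 : 0 < m x by apply: lt_le_trans cm.
  rewrite -{1}(powRr1 (ltW mx0)) -{1}(subrK p 1).
  rewrite powRD; last by apply/implyP => _; rewrite gt_eqF.
  rewrite ler_wpM2r ?powR_ge0//.
  rewrite -(opprB p 1) !powRN lef_pV2 ?posrE ?powR_gt0//.
  by rewrite ge0_ler_powR ?nnegrE ?subr_ge0 ?(ltW p1) ?(ltW c0) ?(ltW mx0).
rewrite ge0_integralD//; first last.
- by apply: emeasurable_funM => //; apply: measurable_funTS; apply/measurable_EFinP.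
- by move=> x _; rewrite -EFinM lee_fin mulr_ge0 ?powR_ge0.
- by move=> x _; rewrite lee_fin ltW.
rewrite ge0_integralZl//; first last.
- by rewrite lee_fin powR_ge0.
- by move=> x _; rewrite lee_fin powR_ge0.
- by apply: measurable_funTS; apply/measurable_EFinP.
rewrite EFinD; apply: leeD.
  have muE : mu `]a, b]%classic = (b - a)%:E.
    rewrite lebesgue_measure_itv/= lte_fin; case: ltP => [_|ba]; first by rewrite EFinB.
    by congr EFin; lra.
  by rewrite integral_cst// [X in (_ * X)%E]muE -EFinM.
by rewrite EFinM lee_wpmul2l ?lee_fin ?powR_ge0 ?energy_inequality.
Qed.

(** At a point of zero slope convexity bounds the available dissipation by
    [- lambda d^p0], while moving by [d] in time [h] dissipates at least about
    [d^p / h^(p - 1)]; since [p <= p0], this is impossible for small [h]. *)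
Lemma stationary_after (t0 : R) : 0 <= t0 -> local_slope f (u t0) = 0%E ->
  forall t, t0 <= t -> u t = u t0.
Proof.
have := p0_ge2; have := p1; have := p_le; have := lambda_lt0 => l0 pp p11 p02.
move=> t00 sl0 T t0T; have [_ _ _ umd _] := um.
have T0 : 0 <= T by lra.
have p00 : 0 < p0 by lra.
pose D := (\int[mu]_(r in `]0, T]) m r)%R + 1.
have D1 : 1 <= D by rewrite lerDr; exact: Rintegral_ge0.
have dD a b : 0 <= a -> a <= b -> b <= T -> mdist (u a) (u b) <= D.
  move=> a0 ab bT; apply: le_trans (umd _ _ a0 ab) _.
  apply: (@le_trans _ _ (\int[mu]_(r in `]0, T]) m r)%R); last by rewrite lerDl.
  rewrite /Rintegral fine_le//.
  - by apply: integrable_fin_num => //; exact: speed_integrable.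
  - by apply: integrable_fin_num => //; exact: speed_integrable.
  apply: ge0_subset_integral => //.
  - exact: speed_measurable_EFin.
  - by move=> x _; rewrite lee_fin.
  - move=> x /=; rewrite !in_itv/= => /andP[ax xb].
    by rewrite (le_lt_trans a0 ax) (le_trans xb bT).
(* [X] and [de] make the two bounds on a displacement [d] in time at most [de]
   contradict each other as [d / 2 <= d / 4] *)
pose X := (4 * - lambda * D `^ (p0 - p))^-1.
have X0 : 0 < X.
  rewrite invr_gt0 !mulr_gt0 ?powR_gt0 ?oppr_gt0//; lra.
pose de := X `^ (p - 1)^-1 / 2.
have de0 : 0 < de by rewrite divr_gt0 ?powR_gt0.
have pm1 : 0 < p - 1 by rewrite subr_gt0.
have step a b : 0 <= a -> a <= b -> b <= T -> b - a <= de ->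
    local_slope f (u a) = 0%E -> u b = u a.
  move=> a0 ab bT bade sa.
  have b0 : 0 <= b by lra.
  pose d := mdist (u a) (u b).
  apply/esym/mdist_positivity; apply/eqP; rewrite eq_le mdist_ge0 andbT leNgt.
  apply/negP; rewrite -/d => d0.
  have ba0 : 0 < b - a.
    rewrite subr_gt0 lt_neqAle ab andbT; apply/eqP => e; move: d0.
    by rewrite /d e mdistxx ltxx.
  pose h := b - a; pose c := d / (2 * h).
  have c0 : 0 < c by rewrite divr_gt0// mulr_gt0.
  have h1 : phi a - phi b <= - lambda * d `^ p0.
    have := slope_upper f_gtNy lambda_lt0 p00 f_convex (fu a0) (fu b0).
    by move=> /(_ 0); rewrite sa mul0r add0r; apply.
  have h2 := dist_le_young a0 ab c0.
  have ch : c * (b - a) = d / 2.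
    by rewrite /c /h invfM mulrA -mulrA mulVf ?mulr1// gt_eqF.
  have h3 : d / 2 <= c `^ (1 - p) * (- lambda * d `^ p0).
    apply: (@le_trans _ _ (c `^ (1 - p) * (phi a - phi b))).
      by move: h2; rewrite ch -/d; lra.
    by rewrite ler_wpM2l ?powR_ge0.
  have cE : c `^ (1 - p) = d * (2 * h) `^ (p - 1) / d `^ p.
    rewrite -(opprB p 1) powRN /c.
    rewrite powRM ?invr_ge0 ?(ltW d0)//; last by rewrite mulr_ge0// ltW.
    have h20 : 0 <= 2 * h by rewrite mulr_ge0// ltW.
    rewrite -(powR_inv1 h20).
    rewrite powRAC powR_inv1 ?powR_ge0// invfM invrK.
    rewrite -[in RHS](@mulr_powRB1 _ d p) ?(ltW d0)//; last by lra.
    by rewrite invfM mulrACA divff ?gt_eqF// mul1r mulrC.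
  have h4 : (2 * h) `^ (p - 1) <= X.
    have XE : X = (X `^ (p - 1)^-1) `^ (p - 1).
      by rewrite -powRrM mulVf ?gt_eqF// powRr1// ltW.
    rewrite XE ge0_ler_powR ?nnegrE ?powR_ge0 ?(ltW pm1)//.
      by rewrite mulr_ge0// ltW.
    by move: bade; rewrite /de -/h ler_pdivlMr// mulrC.
  have h5 : d `^ p0 / d `^ p <= D `^ (p0 - p).
    rewrite -powRB; last by apply/implyP => _; rewrite gt_eqF.
    by rewrite ge0_ler_powR ?nnegrE ?subr_ge0 ?(ltW d0)// ?dD//; lra.
  have : d / 2 <= d / 4.
    apply: (le_trans h3).
    have -> : c `^ (1 - p) * (- lambda * d `^ p0) =
        d * ((2 * h) `^ (p - 1) * (- lambda * (d `^ p0 / d `^ p))).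
      by rewrite cE -!mulrA; congr (_ * (_ * _)); rewrite mulrCA [(_ `^ p)^-1 * _]mulrC.
    rewrite ler_wpM2l ?(ltW d0)//.
    apply: (@le_trans _ _ (X * (- lambda * D `^ (p0 - p)))).
      apply: ler_pM => //; rewrite ?powR_ge0//.
        by rewrite mulr_ge0 ?divr_ge0 ?powR_ge0// oppr_ge0 ltW.
      by rewrite ler_wpM2l// oppr_ge0 ltW.
    rewrite /X -mulrA invfM -mulrA mulVf ?mulr1//.
    have D0 : 0 < D by apply: lt_le_trans D1.
    by rewrite gt_eqF// mulr_gt0 ?oppr_gt0 ?powR_gt0.
  lra.
have iter_ n t : t0 <= t -> t <= T -> t - t0 <= n%:R * de -> u t = u t0.
  elim: n t => [|n IH] t t0t tT.
    by rewrite mul0r => tt0; have -> : t = t0 by lra.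
  rewrite -natr1 mulrDl mul1r => tn.
  have [|tn'] := leP (t - t0) (n%:R * de); first exact: IH.
  pose t' := Num.max t0 (t - de).
  have t't0 : t0 <= t' by rewrite le_max lexx.
  have t't : t' <= t by rewrite ge_max t0t/=; lra.
  have ut' : u t' = u t0.
    apply: IH => //; first lra.
    rewrite lerBlDr ge_max; apply/andP; split; last lra.
    by rewrite lerDr mulr_ge0// ltW.
  have tt' : t - de <= t' by rewrite le_max lexx orbT.
  rewrite -ut'; apply: step => //; rewrite ?ut'//; lra.
have [n hn] : exists n : nat, (T - t0) / de < n%:R.
  by exists (Num.truncn ((T - t0) / de)).+1; exact: truncnS_gt.
by apply: (iter_ n) => //; rewrite -ler_pdivrMr// ltW.
Qed.

(** Zero slope is absorbing by [stationary_after], and positive slope is an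
    open condition by [slope_lsc]: the times of positive slope form an initial
    interval without its right end. *)
Lemma slope_gt0_Tstar t : 0 <= t ->
  (0 < local_slope f (u t))%E = (t%:E < Tstar f +oo%E u)%E.
Proof.
move=> t0; apply/idP/idP => [sl|].
  have [d /= d0 hd] : \forall s \near t, 0 <= s -> (0 < local_slope f (u s))%E.
    have p01 : 1 < p0 by have := p0_ge2; lra.
    have /metricType_numDomainType.nbhs_mdistP[e /= e0 he] :=
      slope_lsc f_gtNy lambda_lt0 p01 f_convex f_lsc (lexx 0) (fu t0) sl.
    apply: filterS (curve_near t0 e0) => s h s0; apply: he => /=.
    by rewrite metric_sym; exact: h.
  rewrite /Tstar; apply: (@lt_le_trans _ _ (t + d / 2)%:E); first by rewrite lte_fin; lra.
  rewrite le_max; apply/orP; right; apply: ereal_sup_ubound.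
  exists (t + d / 2) => //; split; first by split; rewrite ?ltry//; lra.
  apply: hd; last lra.
  by rewrite /= opprD addNKr normrN gtr0_norm; lra.
rewrite /Tstar lt_max lte_fin (ltNge t) t0/= => /ereal_sup_gt[_ [s [[s0 _] sl] <-]].
rewrite lte_fin => ts; rewrite lt_neqAle local_slope_ge0 andbT.
apply/eqP => /esym sl0.
by move: sl; rewrite (stationary_after t0 sl0 (ltW ts)) sl0 ltxx.
Qed.

End convex.
End maximal_slope_curve.

(** * Continuous inverse of a primitive *)

Section ereal_order.
Context {R : realType}.

Lemma ereal_between (x : R) (y : \bar R) : (x%:E < y)%E ->
  exists2 z, x < z & (z%:E < y)%E.
Proof.
case: y => [y| |//]; last by exists (x + 1); rewrite ?ltry ?ltrDl.
by rewrite lte_fin => xy; exists ((x + y) / 2); rewrite ?lte_fin; lra.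
Qed.

(** The open rays generate the topology of the extended reals. *)
Lemma cvg_ereal_order (X : Type) (F : set_system X) (h : X -> \bar R) (l : \bar R) :
  Filter F -> (forall y, (y < l)%E -> \forall s \near F, (y < h s)%E) ->
  (forall y, (l < y)%E -> \forall s \near F, (h s < y)%E) ->
  h s @[s --> F] --> l.
Proof.
move=> FF lo up A; rewrite itv_nbhsE => -[[[[]/= r|[]] [[]/= s|[]]]][]// _.
- rewrite in_itv/= => /andP[rl ls] sub.
  suff : \forall s \near F, A (h s) by [].
  by apply: filterS2 (lo _ rl) (up _ ls) => z rz zs; apply: sub; rewrite /= in_itv/= rz.
- rewrite in_itv/= andbT => rl sub.
  suff : \forall s \near F, A (h s) by [].
  by apply: filterS (lo _ rl) => z rz; apply: sub; rewrite /= in_itv/= rz.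
- rewrite in_itv/= => ls sub.
  suff : \forall s \near F, A (h s) by [].
  by apply: filterS (up _ ls) => z zs; apply: sub; rewrite /= in_itv/= zs.
- rewrite set_itvE => _ sub.
  suff : \forall s \near F, A (h s) by [].
  by apply: filterE => z; apply: sub.
Qed.

End ereal_order.

Section inverse_primitive.
Context {R : realType}.
Local Notation mu := (@lebesgue_measure R).
Variables (w : R -> R) (T : \bar R).

Definition primitive (x : R) : R := (\int[mu]_(r in `]0%R, x]) w r)%R.

Definition primitive_sup : \bar R :=
  maxe 0%E (ereal_sup [set (primitive x)%:E | x in itv0 T]).

(** The generalized inverse of [primitive] on [itv0 T]; from [primitive_sup] on
    it equals [T], finite or not. *)
Definition primitive_inv (s : R) : \bar R :=
  maxe 0%E (ereal_sup [set t%:E | t in [set t | itv0 T t /\ primitive t <= s]]).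

Hypotheses (T0 : (0 <= T)%E) (mw : measurable_fun setT w) (w0 : forall x, 0 <= w x)
  (iw : forall x, (x%:E < T)%E -> mu.-integrable `]0, x] (EFin \o w))
  (wpos : forall a b, 0 <= a -> a < b -> (b%:E < T)%E ->
    0 < (\int[mu]_(r in `]a, b]) w r)%R).

Lemma primitiveB a b : 0 <= a -> a <= b -> (b%:E < T)%E ->
  primitive b - primitive a = (\int[mu]_(r in `]a, b]) w r)%R.
Proof.
by move=> a0 ab bT; rewrite /primitive Rintegral_itvB ?bnd_simp//; exact: iw.
Qed.

Lemma primitive0 : primitive 0 = 0.
Proof. by rewrite /primitive set_itvoc0 Rintegral_set0. Qed.

Lemma primitive_lt a b : 0 <= a -> a < b -> (b%:E < T)%E -> primitive a < primitive b.
Proof. by move=> a0 ab bT; rewrite -subr_gt0 primitiveB ?wpos// ltW. Qed.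

Lemma primitive_le a b : 0 <= a -> a <= b -> (b%:E < T)%E -> primitive a <= primitive b.
Proof.
by move=> a0; rewrite le_eqVlt => /predU1P[->//|ab] bT; rewrite ltW// primitive_lt.
Qed.

Lemma primitive_le_mono a b : itv0 T a -> itv0 T b ->
  (primitive a <= primitive b) = (a <= b).
Proof.
move=> [a0 aT] [b0 bT]; have [ab|ba] := leP a b; first exact: primitive_le.
by apply/negbTE; rewrite -ltNge primitive_lt.
Qed.

Lemma primitive_ge0 x : 0 <= primitive x.
Proof. exact: Rintegral_ge0. Qed.

Lemma primitive_continuous (x : R) : (x%:E < T)%E ->
  {within `[0, x], continuous primitive}.
Proof.
move=> xT; have [x0|x0] := leP 0 x; last first.
  by rewrite set_itv_ge ?bnd_simp -?ltNge//; exact: continuous_subspace0.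
have mwS (D : set R) : measurable_fun D (EFin \o w).
  by apply: measurable_funTS; apply/measurable_EFinP.
have ix : mu.-integrable `[0, x] (EFin \o w).
  have /integrableP[_ lw] := iw xT; apply/integrableP; split; first exact: mwS.
  rewrite -integral_itv_obnd_cbnd//.
  by apply: measurableT_comp.
have := parameterized_integral_continuous x0 ix.
suff -> : primitive = (fun y => parameterized_integral mu 0 y w) by [].
apply/funext => y; rewrite /primitive /parameterized_integral /Rintegral.
by rewrite integral_itv_obnd_cbnd.
Qed.

Lemma primitive_sup_gt y : 0 <= y -> (y%:E < primitive_sup)%E ->
  exists2 x, itv0 T x & y < primitive x.
Proof.
move=> y0; rewrite /primitive_sup lt_max lte_fin (ltNge y) y0/=.
by move=> /ereal_sup_gt[_ [x xT <-]]; rewrite lte_fin; exists x.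
Qed.

Lemma primitive_surj y : 0 <= y -> (y%:E < primitive_sup)%E ->
  exists2 x, itv0 T x & primitive x = y.
Proof.
move=> y0 /(primitive_sup_gt y0)[b [b0 bT] yb].
have [|x] := @IVT R primitive 0 b y b0 (primitive_continuous bT).
  by rewrite primitive0 ge_min y0/= le_max (ltW yb) orbT.
rewrite in_itv/= => /andP[x0 xb] xy; exists x => //; split => //.
by apply: le_lt_trans bT; rewrite lee_fin.
Qed.

Lemma primitive_lt_sup x : itv0 T x -> ((primitive x)%:E < primitive_sup)%E.
Proof.
move=> [x0 xT]; have [z xz zT] := ereal_between xT.
apply: (@lt_le_trans _ _ (primitive z)%:E).
  by rewrite lte_fin primitive_lt.
rewrite /primitive_sup le_max; apply/orP; right; apply: ereal_sup_ubound.
by exists z => //; split => //; lra.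
Qed.

Lemma primitive_inv_ge0 s : (0 <= primitive_inv s)%E.
Proof. by rewrite /primitive_inv le_max lexx. Qed.

Lemma primitive_inv_le s (y : \bar R) : (0 <= y)%E ->
  (forall t, itv0 T t -> primitive t <= s -> (t%:E <= y)%E) ->
  (primitive_inv s <= y)%E.
Proof.
move=> y0 h; rewrite /primitive_inv ge_max y0/=; apply: ge_ereal_sup.
by move=> _ [t [tT ts] <-]; exact: h.
Qed.

Lemma primitive_inv_ge s t : itv0 T t -> primitive t <= s -> (t%:E <= primitive_inv s)%E.
Proof.
move=> tT ts; rewrite /primitive_inv le_max; apply/orP; right.
by apply: ereal_sup_ubound; exists t.
Qed.

Lemma primitive_invE x : itv0 T x -> primitive_inv (primitive x) = x%:E.
Proof.
move=> xT; apply/eqP; rewrite eq_le primitive_inv_ge// andbT.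
apply: primitive_inv_le => [|t tT]; first by have [x0 _] := xT.
by rewrite primitive_le_mono// lee_fin.
Qed.

Lemma primitive_inv_leT s : (primitive_inv s <= T)%E.
Proof. by apply: primitive_inv_le => // t [_ /ltW]. Qed.

Lemma primitive_inv_nd s t : s <= t -> (primitive_inv s <= primitive_inv t)%E.
Proof.
move=> st; apply: primitive_inv_le; first exact: primitive_inv_ge0.
by move=> x xT xs; apply: primitive_inv_ge => //; exact: le_trans st.
Qed.

Lemma primitive_inv_geT s : (primitive_sup <= s%:E)%E -> primitive_inv s = T.
Proof.
move=> ss; apply/eqP; rewrite eq_le primitive_inv_leT/= leNgt; apply/negP.
have := primitive_inv_ge0 s; case E : (primitive_inv s) => [r| |//].
  rewrite lee_fin => r0 /ereal_between[z rz zT].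
  have zT' : itv0 T z by split => //; lra.
  have zs : primitive z <= s.
    by rewrite -lee_fin; apply: le_trans ss; exact/ltW/primitive_lt_sup.
  by have := primitive_inv_ge zT' zs; rewrite E lee_fin; lra.
by move=> _; rewrite ltNge leey.
Qed.

Lemma primitive_inv_ltP s : 0 <= s -> (s%:E < primitive_sup)%E ->
  exists x, [/\ itv0 T x, primitive x = s & primitive_inv s = x%:E].
Proof.
move=> s0 /(primitive_surj s0)[x xT <-]; exists x; split => //.
exact: primitive_invE.
Qed.

Lemma primitive_inv_continuous : {within `[0, +oo[, continuous primitive_inv}.
Proof.
apply/subspace_continuousP => s0; rewrite /= in_itv/= andbT => s00.
apply: cvg_ereal_order => y.
  have [y0|y0] := ltP y 0%E.
    move=> _; apply: nearW => s; apply: lt_le_trans y0 _.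
    exact: primitive_inv_ge0.
  rewrite {1}/primitive_inv lt_max (ltNge y) y0/=.
  move=> /ereal_sup_gt[_ [t [tT ts] <-]] yt; have [t0 tT'] := tT.
  move: y0 yt; case: y => [r| |//]; last by move=> _; rewrite ltNge leey.
  rewrite lee_fin lte_fin => r0 rt.
  pose r' := (r + t) / 2; have rr' : r < r' by rewrite /r'; lra.
  have r't : r' < t by rewrite /r'; lra.
  have r'T : itv0 T r' by split; [lra|apply: lt_trans tT'; rewrite lte_fin].
  have : \forall s \near s0, primitive r' < s.
    by apply: lt_nbhsr; apply: lt_le_trans ts; apply: primitive_lt => //; lra.
  move=> h; apply: cvg_within; apply: filterS h => s hs.
  apply: (@lt_le_trans _ _ r'%:E); first by rewrite lte_fin.
  by apply: primitive_inv_ge => //; exact: ltW.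
have [TE|] := leP T (primitive_inv s0).
  move=> sy; apply: nearW => s; apply: le_lt_trans sy.
  exact: le_trans (primitive_inv_leT _) TE.
move=> sT sy; have sS : (s0%:E < primitive_sup)%E.
  by rewrite ltNge; apply/negP => /primitive_inv_geT h; move: sT; rewrite h ltxx.
have [x [xT xs xE]] := primitive_inv_ltP s00 sS.
have [z xz] : exists2 z, x < z & (z%:E < Order.min y T)%E.
  by apply: ereal_between; rewrite lt_min -xE sy.
rewrite lt_min => /andP[zy zT].
have zT' : itv0 T z by split => //; have [? _] := xT; lra.
have : \forall s \near s0, s < primitive z.
  by apply: lt_nbhsl; rewrite -xs primitive_lt//; have [] := xT.
move=> h; apply: cvg_within; apply: filterS h => s hs.
apply: le_lt_trans zy; apply: primitive_inv_le => [|t tT ts].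
  by have [] := zT'.
by rewrite lee_fin -primitive_le_mono// (le_trans ts)// ltW.
Qed.

End inverse_primitive.

(** * Powers of the speed *)

Section exhaustion.
Context {R : realType}.
Local Notation mu := (@lebesgue_measure R).

Lemma nondecreasing_ereal_measurable (h : R -> \bar R) :
  (forall s t, s <= t -> (h s <= h t)%E) -> measurable_fun setT h.
Proof.
move=> ndh; apply: (measurability _ (ErealGenCInfty.measurableE R)) => _ [_ [r ->] <-].
apply: measurableI => //; apply: is_interval_measurable => s t/=.
rewrite !in_itv/= !andbT => fs ft z /andP[sz zt].
by rewrite in_itv/= andbT (le_trans fs)// ndh.
Qed.

Lemma itv0_exhaustion (T : \bar R) : (0 < T)%E -> exists x : nat -> R,
  [/\ nondecreasing_seq x, (forall n, itv0 T (x n)) &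
      forall y, (y%:E < T)%E -> exists n, y <= x n].
Proof.
case: T => [r| |//]; last first.
  move=> _; exists (fun n => n%:R); split => [m n mn|n|y _].
  - by rewrite ler_nat.
  - by split; rewrite ?ltry.
  - by exists (Num.truncn y).+1; rewrite ltW// truncnS_gt.
rewrite lte_fin => r0; exists (fun n => r - r / n.+1%:R); split => [m n mn|n|y].
- by rewrite lerD2l lerN2 ler_wpM2l ?(ltW r0)// lef_pV2 ?posrE// ler_nat.
- split.
    rewrite subr_ge0 ler_pdivrMr// ler_peMr ?(ltW r0)//.
    by rewrite (_ : 1 = 1%:R)// ler_nat.
  by rewrite lte_fin ltrBlDr ltrDl divr_gt0.
- rewrite lte_fin => yr; exists (Num.truncn (r / (r - y))).
  rewrite lerBrDr -lerBrDl ler_pdivrMr// mulrC -ler_pdivrMr ?subr_gt0//.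
  by rewrite ltW// truncnS_gt.
Qed.

(** Integrals over a half-open interval, bounded or not, are limits of
    integrals over compact ones. *)
Lemma ge0_integral_itv0_le (T : \bar R) (g : R -> R) (C : \bar R) :
  measurable_fun setT g -> (forall x, 0 <= g x) -> (0 <= C)%E ->
  (forall x, itv0 T x -> (\int[mu]_(r in `]0%R, x]) (g r)%:E <= C)%E) ->
  (\int[mu]_(r in itv0 T) (g r)%:E <= C)%E.
Proof.
move=> mg g0 C0 h; have [T0|T0] := leP T 0%E.
  have -> : itv0 T = set0.
    rewrite -subset0 => x [x0 xT].
    by have := lt_le_trans xT T0; rewrite lte_fin ltNge x0.
  by rewrite integral_set0.
have [x [ndx xT xex]] := itv0_exhaustion T0.
pose F n : set (measurableTypeR R) := `[0, x n]%classic.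
have FE : itv0 T = \bigcup_n F n.
  apply/seteqP; split => [y [y0 yT]|y [n _]].
    by have [n yn] := xex _ yT; exists n => //; rewrite /F /= in_itv/= y0.
  rewrite /F /= in_itv/= => /andP[y0 yn]; split => //.
  by apply: le_lt_trans (xT n).2; rewrite lee_fin.
have mF n : measurable (F n) by exact: measurable_itv.
have ndF : nondecreasing_seq F.
  move=> a b ab; apply/subsetPset => y; rewrite /F /= !in_itv/= => /andP[-> ya].
  by rewrite (le_trans ya)// ndx.
have mgS (D : set R) : measurable_fun D (EFin \o g).
  by apply: measurable_funTS; apply/measurable_EFinP.
have := @ge0_nondecreasing_set_cvg_integral _ _ _ F (EFin \o g) mu ndF mF.
rewrite -FE => cv.
have {}cv : (\int[mu]_(r in F n) (g r)%:E)%E @[n --> \oo] --> (\int[mu]_(r in itv0 T) (g r)%:E)%E.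
  by apply: cv => [n|n y _]; [exact: mgS|rewrite lee_fin].
rewrite -(cvg_lim _ cv)//; apply: lime_le; first by apply/cvg_ex; eexists; exact: cv.
apply: nearW => n; rewrite /F -integral_itv_obnd_cbnd//; exact: h.
Qed.

End exhaustion.

Section speed_power.
Context {R : realType} {S : completeMetricType R}.
Local Notation mu := (@lebesgue_measure R).
Variables (p p' : R).
Hypotheses (p1 : 1 < p) (p'1 : 1 < p').

(** If [u] has speed [x], the curve transformed from exponent [p] to [p'] has
    speed [x] to this power at the same point. *)
Definition time_exp : R := (p - 1) / (p' - 1).

Lemma alpha_expE : alpha_exp p p' = 1 - time_exp.
Proof.
have p0 : p != 0 by rewrite gt_eqF// (lt_trans _ p1).
have p'0 : p' != 0 by rewrite gt_eqF// (lt_trans _ p'1).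
rewrite /alpha_exp /time_exp !conj_expE//; congr (1 - _).
have p10 : p - 1 != 0 by rewrite gt_eqF// subr_gt0.
have p'10 : p' - 1 != 0 by rewrite gt_eqF// subr_gt0.
by field; rewrite p'10 p'0 p10 p0.
Qed.

Lemma time_exp_gt0 : 0 < time_exp.
Proof. by rewrite divr_gt0 ?subr_gt0. Qed.

Lemma time_expM : time_exp * (p' - 1) = p - 1.
Proof. by rewrite /time_exp divfK// gt_eqF// subr_gt0. Qed.

Lemma time_expMp' : time_exp * p' = p - alpha_exp p p'.
Proof.
by rewrite alpha_expE; have := time_expM; rewrite mulrBr mulr1; lra.
Qed.

(** For a negative exponent the power is bounded because [x] stays away
    from 0, for an exponent in [`[0, 1[] because it grows at most linearly. *)
Lemma powR_le_affine (c x a : R) : 0 < c -> c <= x -> a < 1 ->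
  x `^ a <= 1 + c `^ a + x.
Proof.
move=> c0 cx a1; have x0 : 0 < x by apply: lt_le_trans cx.
have := powR_ge0 c a.
have [x1|/ltW x1] := leP 1 x.
  by have := ler1_powR x1 (ltW a1); lra.
have [a0|/ltW a0] := leP 0 a.
  suff : x `^ a <= 1 by lra.
  by rewrite -[leRHS](powRr0 x); apply: ger_powR; rewrite ?x0.
suff : x `^ a <= c `^ a by lra.
rewrite -[a]opprK !(powRN _ (- a)) lef_pV2 ?posrE ?powR_gt0//.
by rewrite ge0_ler_powR ?nnegrE ?oppr_ge0// ltW.
Qed.

Lemma powR_time_exp (x : R) : 0 <= x -> x `^ time_exp * x `^ alpha_exp p p' = x.
Proof.
move=> x0; have [->|xn0] := eqVneq x 0.
  by rewrite powR0 ?mul0r// gt_eqF// time_exp_gt0.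
rewrite -powRD; last by apply/implyP.
by rewrite alpha_expE addrC subrK powRr1.
Qed.

End speed_power.

Section speed_weight.
Context {R : realType} {S : completeMetricType R}.
Local Notation mu := (@lebesgue_measure R).
Variables (f : S -> \bar R) (p p' p0 lambda : R) (u : R -> S) (m : R -> R).
Hypotheses (f_gtNy : forall v, (-oo < f v)%E) (f_lsc : lower_semicontinuous f)
  (lambda_lt0 : lambda < 0) (p0_ge2 : 2 <= p0) (f_convex : pl_convex f p0 lambda)
  (p1 : 1 < p) (p_le : p <= p0) (p'1 : 1 < p')
  (um : maximal_speed f p u m) (fu : forall t, 0 <= t -> (f (u t) < +oo)%E)
  (nonincr : forall s t, 0 <= s -> s <= t -> (f (u t) <= f (u s))%E).

Local Notation T := (Tstar f +oo%E u).
Local Notation a := (alpha_exp p p').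
Local Notation w := (fun r => m r `^ a).

Let mm : measurable_fun setT m. Proof. by case: um. Qed.
Let m0 t : 0 <= m t. Proof. by case: um. Qed.

Let slopeT t : 0 <= t -> (0 < local_slope f (u t))%E = (t%:E < T)%E.
Proof. exact: (slope_gt0_Tstar f_gtNy p1 um fu nonincr lambda_lt0 p0_ge2 p_le f_convex f_lsc). Qed.

Lemma Tstar_ge0 : (0 <= T)%E. Proof. by rewrite /Tstar le_max lexx. Qed.

Lemma weight_ge0 x : 0 <= w x. Proof. exact: powR_ge0. Qed.

Lemma weight_measurable : measurable_fun setT w.
Proof. exact: (measurableT_comp (measurable_powR a)). Qed.

(** Lower semicontinuity of the slope and compactness keep the slope away from
    0 before [T]. *)
Lemma slope_bounded_below (x : R) : (x%:E < T)%E ->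
  exists2 c : R, 0 < c & forall t, 0 <= t <= x -> (c%:E < local_slope f (u t))%E.
Proof.
move=> xT.
pose P (n : nat) (s : R) := 0 <= s -> ((n.+1%:R^-1)%:E < local_slope f (u s))%E.
have p01 : 1 < p0 by have := p0_ge2; lra.
have /compact_near_coveringP cov := @segment_compact R 0 x.
have [|N _ hN] := cov nat \oo P _.
  move=> t; rewrite /= in_itv/= => /andP[t0 tx].
  have slt : (0 < local_slope f (u t))%E.
    by rewrite slopeT//; apply: le_lt_trans xT; rewrite lee_fin.
  have [c c0 cs] := ereal_between slt.
  have /metricType_numDomainType.nbhs_mdistP[e /= e0 he] :=
    slope_lsc f_gtNy lambda_lt0 p01 f_convex f_lsc (ltW c0) (fu t0) cs.
  have near1 : \forall s \near t, 0 <= s -> (c%:E < local_slope f (u s))%E.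
    apply: filterS (curve_near um t0 e0) => s h s0; apply: he => /=.
    by rewrite metric_sym; exact: h.
  have near2 : \forall n \near \oo, n.+1%:R^-1 < c.
    have /cvgrPdist_lt/(_ _ c0) := @cvg_harmonic R.
    apply: filterS => n; rewrite sub0r normrN; apply: le_lt_trans.
    exact: ler_norm.
  exists ([set s | 0 <= s -> (c%:E < local_slope f (u s))%E], [set n | n.+1%:R^-1 < c]).
    by split.
  move=> [s n] [/= hs hn] s0; apply: lt_trans (hs s0).
  by rewrite lte_fin.
exists N.+1%:R^-1; first by rewrite invr_gt0.
move=> t tx; apply: (hN N) => //=.
by case/andP : tx.
Qed.

Lemma speed_gt0 : {ae mu, forall t, 0 < t -> (t%:E < T)%E -> 0 < m t}.
Proof.
have [_ _ _ _ aem] := um; apply: aeS aem => t h t0 tT.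
have [_ _] := h t0; have := slopeT (ltW t0); rewrite tT => + slE.
rewrite slE lte_fin => mp; rewrite lt_neqAle eq_sym m0 andbT.
apply/eqP => mt; move: mp; rewrite mt powR0 ?ltxx// subr_eq0 gt_eqF//.
Qed.

(** A lower bound on the slope is one on the speed, so [powR_le_affine]
    dominates the weight by an affine function of the speed. *)
Lemma weight_integrable (x : R) : (x%:E < T)%E -> mu.-integrable `]0, x] (EFin \o w).
Proof.
move=> xT; have [c c0 cs] := slope_bounded_below xT.
pose d := c `^ (p - 1)^-1.
have pm1 : 0 < p - 1 by rewrite subr_gt0.
have d0 : 0 < d by rewrite powR_gt0.
have a1 : a < 1 by rewrite alpha_expE// ltrBlDr ltrDl time_exp_gt0.
have mwS (D : set R) : measurable_fun D (EFin \o w).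
  by apply: measurable_funTS; apply/measurable_EFinP; exact: weight_measurable.
have mub (D : set R) : measurable_fun D (fun r => (1 + d `^ a + m r)%:E).
  by apply: measurable_funTS; apply/measurable_EFinP; apply: measurable_funD.
apply/integrableP; split; first exact: mwS.
apply: (@le_lt_trans _ _ (\int[mu]_(r in `]0%R, x]) (1 + d `^ a + m r)%R%:E)%E).
  apply: ae_ge0_le_integral => //.
  - by apply: measurableT_comp => //; exact: mwS.
  - by move=> r _; rewrite lee_fin !addr_ge0 ?powR_ge0.
  - exact: mub.
  have [_ _ _ _ aem] := um; apply: aeS aem => t h /=; rewrite in_itv/= => /andP[t0 tx].
  rewrite ger0_norm ?powR_ge0// lee_fin powR_le_affine//.
  have [_ _ slE] := h t0.
  have : (c%:E < local_slope f (u t))%E by apply: cs; rewrite (ltW t0).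
  rewrite slE lte_fin => cm.
  rewrite -[leRHS]powRr1// -(mulfV (lt0r_neq0 pm1)) powRrM.
  by rewrite ge0_ler_powR ?nnegrE ?invr_ge0 ?powR_ge0 ?(ltW c0) ?(ltW pm1) ?(ltW cm).
under eq_integral do rewrite EFinD.
rewrite ge0_integralD//.
- apply: lte_add_pinfty.
    rewrite integral_cst//; apply: lte_mul_pinfty => //.
    + by rewrite lee_fin addr_ge0 ?powR_ge0.
    + rewrite [ltLHS](_ : _ = mu `]0%R, x]%classic)// lebesgue_measure_itv/=.
      by case: ifP; rewrite ?ltry// -EFinB ltry.
  rewrite -ge0_fin_numE; last by apply: integral_ge0 => r _; rewrite lee_fin.
  by apply: integrable_fin_num => //; exact: (speed_integrable um).
- by move=> r _; rewrite lee_fin addr_ge0 ?powR_ge0.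
- by move=> r _; rewrite lee_fin.
- exact: (speed_measurable_EFin um).
Qed.

Lemma weight_integral_gt0 (c b : R) : 0 <= c -> c < b -> (b%:E < T)%E ->
  0 < (\int[mu]_(r in `]c, b]) w r)%R.
Proof.
move=> c0 cb bT.
have mwS (D : set R) : measurable_fun D (EFin \o w).
  by apply: measurable_funTS; apply/measurable_EFinP; exact: weight_measurable.
rewrite lt_neqAle eq_sym Rintegral_ge0 ?andbT; last by move=> x _; exact: weight_ge0.
apply/eqP => h0.
have iw : mu.-integrable `]c, b] (EFin \o w).
  apply: integrableS (weight_integrable bT) => // x /=; rewrite !in_itv/= => /andP[cx ->].
  by rewrite (le_lt_trans c0 cx).
have : (\int[mu]_(r in `]c, b]) `|(w r)%:E|)%E = 0%E.
  under eq_integral do rewrite gee0_abs ?lee_fin ?weight_ge0//.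
  by rewrite -[LHS]fineK; [congr EFin|exact: integrable_fin_num].
move=> /ae_eq_integral_abs => /(_ (measurable_itv _) (mwS _)) w00.
have : {ae mu, forall t : R, ~ (c < t <= b)}.
  apply: aeS2 w00 speed_gt0 => t h1 h2 /andP[ct tb].
  have : (w t)%:E = 0%E by apply: h1; rewrite /= in_itv/= ct.
  move=> [] /powR_eq0_eq0 mt.
  have := h2 (le_lt_trans c0 ct); rewrite mt ltxx => h; suff : false by [].
  by apply: h; apply: le_lt_trans bT; rewrite lee_fin.
move=> [N [mN N0 hN]].
have : (mu `]c, b]%classic <= mu N)%E.
  apply: le_measure; [by rewrite inE; exact: measurable_itv|by rewrite inE|].
  by move=> t; rewrite /= in_itv/= => ct; apply: hN => /= h; exact: (h ct).
rewrite N0 lebesgue_measure_itv/= lte_fin cb -EFinB lee_fin; lra.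
Qed.

(** Differentiation of integrals, applied to the restrictions of the weight to
    the members of an exhaustion of [itv0 T]. *)
Lemma weight_derive : {ae mu, forall t, 0 < t -> (t%:E < T)%E ->
  is_derive t (1 : R) (primitive w) (w t)}.
Proof.
have [T0|T0] := leP T 0%E.
  apply: aeW => t t0 tT; exfalso; have := lt_le_trans tT T0.
  by rewrite lte_fin ltNge (ltW t0).
have [x [_ xT xex]] := itv0_exhaustion T0.
have : {ae mu, forall (t : R) n, 0 < t < x n -> is_derive t (1 : R) (primitive w) (w t)}.
  apply: ae_foralln => n.
  pose wn : R -> R := w \_ `]0, (x n)].
  have mJ : measurable (`]0, (x n)]%classic : set (measurableTypeR R)) by exact: measurable_itv.
  have iwn : mu.-integrable setT (EFin \o wn).
    rewrite /wn -restrict_EFin.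
    exact: ((@integrable_mkcond _ _ _ mu _ _ mJ).1 (weight_integrable (xT n).2)).
  pose phi (t : R) := (\int[mu]_(r in `]-oo, t]) wn r)%R.
  have wn0 (r : R) : 0 <= wn r by rewrite /wn patchE; case: ifP => // _; exact: weight_ge0.
  have phiE (s t : R) : s <= t -> (phi t - phi s = \int[mu]_(r in `]s, t]) wn r)%R.
    exact: (primitive_increment iwn).
  have := ae_is_derive_primitive iwn phiE.
  apply: aeS => t dphi /andP[t0 tx].
  have wE : wn t = w t by rewrite /wn patchE mem_set//= in_itv/= t0 ltW.
  rewrite -wE -[wn t]subr0 -[0]opprK -[wn t - _]addr0.
  apply: (@near_eq_is_derive _ _ _ (fun s => phi s - phi 0)).
    have : \forall s \near t, s \in `]0, (x n)[ by apply: near_in_itvoo; rewrite in_itv/= t0.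
    apply: filterS => s; rewrite in_itv/= => /andP[s0 sx].
    rewrite phiE ?(ltW s0)// /primitive; apply: eq_Rintegral => r.
    rewrite inE/= in_itv/= => /andP[r0 rs].
    by rewrite /wn patchE mem_set//= in_itv/= r0 (le_trans rs)// ltW.
  rewrite opprK subr0 addr0; rewrite -[X in is_derive _ _ _ X]subr0.
  by apply: is_deriveB.
apply: aeS => t h t0 tT; have [z tz zT] := ereal_between tT.
have [n zn] := xex _ zT.
by apply: (h n); rewrite t0 (lt_le_trans tz zn).
Qed.

(** The quantity entering the change of time may be computed from [m],
    although the metric derivative itself need not be measurable. *)
Lemma metric_derivative_integral (D : set R) : measurable D ->
  (forall r, D r -> 0 <= r) ->
  (\int[mu]_(r in D) (metric_derivative u r `^ a)%:E = \int[mu]_(r in D) (w r)%:E)%E.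
Proof.
move=> mD D0; apply: ge0_ae_eq_integral_nomeas => //.
- by move=> r _; rewrite lee_fin powR_ge0.
- by move=> r _; rewrite lee_fin powR_ge0.
- by apply: measurable_funTS; apply/measurable_EFinP; exact: weight_measurable.
have [_ _ _ _ aem] := um; apply: aeS2 (ae_neq 0) aem => t tn0 h Dt.
have t0 : 0 < t by rewrite lt_neqAle eq_sym tn0 D0.
by have [qt _ _] := h t0; rewrite (metric_derivativeE qt).
Qed.

End speed_weight.

(** * Transformation of a curve of maximal slope *)

Lemma eq_ereal_lower (R : realType) (x y : \bar R) : (0 <= x)%E -> (0 <= y)%E ->
  (forall r : R, 0 <= r -> (r%:E < x)%E = (r%:E < y)%E) -> x = y.
Proof.
suff H a b : (0 <= a)%E -> (forall r : R, 0 <= r -> (r%:E < b)%E -> (r%:E < a)%E) -> (b <= a)%E.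
  move=> x0 y0 h; apply/eqP; rewrite eq_le; apply/andP; split; apply: H => // r r0.
    by rewrite h.
  by rewrite -h.
case: a => [r| |//]; last by move=> _ _; rewrite leey.
rewrite lee_fin => r0 h; rewrite leNgt; apply/negP => rb.
by have := h r r0 rb; rewrite ltxx.
Qed.

Section time_map.
Context {R : realType} {S : completeMetricType R}.
Local Notation mu := (@lebesgue_measure R).

(** The inverse of the primitive of [|u'|^alpha] on [itv0 (Tstar f +oo u)],
    continued by [Tstar f +oo u]. *)
Definition time_map (f : S -> \bar R) (p p' : R) (u : R -> S) (s : R) : \bar R :=
  maxe 0%E (ereal_sup [set t%:E | t in [set t | itv0 (Tstar f +oo%E u) t /\
    (\int[mu]_(r in `]0%R, t]) (metric_derivative u r `^ alpha_exp p p')%:E <= s%:E)%E]]).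

(** The metric derivative at a positive time depends only on the curve near
    that time, hence on positive times. *)
Lemma time_map_ext f p p' (u v : R -> S) s : (forall t, 0 <= t -> v t = u t) ->
  time_map f p p' u s = time_map f p p' v s.
Proof.
move=> vu.
have SE : [set t | itv0 +oo%E t /\ (0 < local_slope f (u t))%E] =
    [set t | itv0 +oo%E t /\ (0 < local_slope f (v t))%E].
  apply/seteqP; split => t [tT].
    by rewrite -(vu t tT.1) => sl; exact: (conj tT sl).
  by rewrite (vu t tT.1) => sl; exact: (conj tT sl).
have TE : Tstar f +oo%E u = Tstar f +oo%E v :=
  congr1 (fun A => maxe 0%E (ereal_sup [set t%:E | t in A])) SE.
have mdE r : 0 < r -> metric_derivative u r = metric_derivative v r.
  move=> r0; pose q (g : R -> S) (s : R) := mdist (g r) (g s) / `|r - s|.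
  have E : \forall s \near r^', q u s = q v s.
    have : \forall s \near r, 0 < s := lt_nbhsr r0.
    move=> h; apply: cvg_within; apply: filterS h => z z0.
    by rewrite /q (vu z (ltW z0)) (vu r (ltW r0)).
  have E' : \forall s \near r^', q v s = q u s by apply: filterS E => z ->.
  suff : q u @ r^' = q v @ r^' by rewrite /metric_derivative => ->.
  by rewrite eqEsubset; split; apply: near_eq_cvg.
have intE t : (\int[mu]_(r in `]0%R, t]) (metric_derivative u r `^ alpha_exp p p')%:E)%E =
    (\int[mu]_(r in `]0%R, t]) (metric_derivative v r `^ alpha_exp p p')%:E)%E.
  by apply: eq_integral => r; rewrite inE/= in_itv/= => /andP[r0 _]; rewrite (mdE r r0).
rewrite /time_map -TE.
refine (congr1 (fun A => maxe 0%E (ereal_sup [set t%:E | t in A])) _).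
apply/seteqP; split => t [tT].
  by rewrite intE => h; exact: (conj tT h).
by rewrite -intE => h; exact: (conj tT h).
Qed.

End time_map.

Section time_changed_curve.
Context {R : realType} {S : completeMetricType R}.
Local Notation mu := (@lebesgue_measure R).
Variables (f : S -> \bar R) (p p' p0 lambda : R) (u : R -> S) (m : R -> R).
Hypotheses (f_gtNy : forall v, (-oo < f v)%E) (f_lsc : lower_semicontinuous f)
  (lambda_lt0 : lambda < 0) (p0_ge2 : 2 <= p0) (f_convex : pl_convex f p0 lambda)
  (p1 : 1 < p) (p_le : p <= p0) (p'1 : 1 < p')
  (um : maximal_speed f p u m) (fu : forall t, 0 <= t -> (f (u t) < +oo)%E)
  (nonincr : forall s t, 0 <= s -> s <= t -> (f (u t) <= f (u s))%E).

Local Notation T := (Tstar f +oo%E u).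
Local Notation a := (alpha_exp p p').
Local Notation k := (time_exp p p').
Local Notation w := (fun r => m r `^ a).
Local Notation F := (primitive w).
Local Notation S0 := (primitive_sup w T).
Local Notation tau := (primitive_inv w T).

Hypothesis ulim : T = +oo%E -> (S0 < +oo)%E -> cvg (u t @[t --> +oo]).

Let uT := curve_at u T.
Let v (s : R) := curve_at u (tau s).
Let tm s := fine (tau s).

(** By the chain rule the speed [m] is divided by [m^alpha]; once the end point
    is reached the speed is 0. *)
Definition changed_speed (s : R) : R :=
  if (s%:E < S0)%E then m (tm s) `^ k else 0.

Local Notation m' := changed_speed.

Let mm : measurable_fun setT m. Proof. by case: um. Qed.
Let m0 t : 0 <= m t. Proof. by case: um. Qed.
Let umd s t : 0 <= s -> s <= t -> mdist (u s) (u t) <= (\int[mu]_(r in `]s, t]) m r)%R.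
Proof. by case: um => _ _ _ + _; apply. Qed.

Let T0 := Tstar_ge0 f u.
Let mw : measurable_fun setT w := weight_measurable p' um.
Let w0 (x : R) : 0 <= w x := weight_ge0 p p' m x.
Let iw x : (x%:E < T)%E -> mu.-integrable `]0, x] (EFin \o w).
Proof. exact: (weight_integrable f_gtNy f_lsc lambda_lt0 p0_ge2 f_convex p1 p_le p'1 um fu nonincr). Qed.
Let wpos c b : 0 <= c -> c < b -> (b%:E < T)%E -> 0 < (\int[mu]_(r in `]c, b]) w r)%R.
Proof. exact: (weight_integral_gt0 f_gtNy f_lsc lambda_lt0 p0_ge2 f_convex p1 p_le p'1 um fu nonincr). Qed.

Let slopeT t : 0 <= t -> (0 < local_slope f (u t))%E = (t%:E < T)%E.
Proof. exact: (slope_gt0_Tstar f_gtNy p1 um fu nonincr lambda_lt0 p0_ge2 p_le f_convex f_lsc). Qed.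

Ltac prim := first [exact: T0|exact: mw|exact: w0|exact: iw|exact: wpos].

Let F0 : F 0 = 0. Proof. exact: primitive0. Qed.
Let F_inv x : itv0 T x -> tau (F x) = x%:E.
Proof. by apply: primitive_invE => *; prim. Qed.
Let F_lt x : itv0 T x -> ((F x)%:E < S0)%E.
Proof. by apply: primitive_lt_sup => *; prim. Qed.
Let F_mono x y : itv0 T x -> itv0 T y -> (F x <= F y) = (x <= y).
Proof. by apply: primitive_le_mono => *; prim. Qed.
Let tau_ltP s : 0 <= s -> (s%:E < S0)%E ->
  exists x, [/\ itv0 T x, F x = s & tau s = x%:E].
Proof. by apply: primitive_inv_ltP => *; prim. Qed.
Let tau_geT s : (S0 <= s%:E)%E -> tau s = T.
Proof. by apply: primitive_inv_geT => *; prim. Qed.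
Let tau_nd s t : s <= t -> (tau s <= tau t)%E.
Proof. by apply: primitive_inv_nd => *; prim. Qed.
Let F_ge0 x : 0 <= F x.
Proof. by apply: primitive_ge0 => *; prim. Qed.
Let S0_ge0 : (0 <= S0)%E. Proof. by rewrite /primitive_sup le_max lexx. Qed.

Let tm_F x : itv0 T x -> tm (F x) = x.
Proof. by move=> xT; rewrite /tm F_inv. Qed.

Let v_F x : itv0 T x -> v (F x) = u x.
Proof. by move=> xT; rewrite /v F_inv. Qed.

Let itv0_le x y : 0 <= x -> x <= y -> itv0 T y -> itv0 T x.
Proof. by move=> x0 xy [_ yT]; split => //; apply: le_lt_trans yT. Qed.

Let v_geT s : (S0 <= s%:E)%E -> v s = uT.
Proof. by move=> Ss; rewrite /v tau_geT. Qed.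

Let mtm : measurable_fun setT tm.
Proof.
apply: (measurableT_comp (f := fine)); first exact: fine_measurable.
exact: nondecreasing_ereal_measurable tau_nd.
Qed.

Let mmk : measurable_fun setT (fun x => m x `^ k).
Proof. exact: (measurableT_comp (measurable_powR k)). Qed.

Lemma changed_speed_ge0 s : 0 <= m' s.
Proof. by rewrite /changed_speed; case: ifP => // _; exact: powR_ge0. Qed.

Lemma changed_speed_measurable : measurable_fun setT m'.
Proof.
apply: measurable_fun_if => //.
- apply: (@measurable_fun_bool _ _ _ _ true); rewrite setTI.
  apply: is_interval_measurable => x y /= _ yS z /andP[_ zy].
  by apply: le_lt_trans yS; rewrite lee_fin.
- by apply: measurable_funTS; exact: (measurableT_comp mmk mtm).
Qed.

Let mm'S (D : set R) : measurable_fun D (EFin \o m').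
Proof. by apply: measurable_funTS; apply/measurable_EFinP; exact: changed_speed_measurable. Qed.

Let Fw (c b : R) : itv0 T c -> itv0 T b -> forall x, c <= x <= b ->
  (F x - F c = \int[mu]_(r in `]c, x]) w r)%R.
Proof.
move=> cT bT x /andP[cx xb]; apply: (@primitiveB _ _ T) => // *; try prim.
- by have [] := cT.
- by apply: le_lt_trans bT.2; rewrite lee_fin.
Qed.

Let lt_supF b s : itv0 T b -> s <= F b -> (s%:E < S0)%E.
Proof. by move=> bT sb; apply: le_lt_trans (F_lt bT); rewrite lee_fin. Qed.

Let tmF (c b : R) : itv0 T c -> itv0 T b -> forall s x, F c < s <= F b ->
  c <= x <= b -> (tm s <= x) = (s <= F x).
Proof.
move=> cT bT s x /andP[cs sb] /andP[cx xb].
have s0 : 0 <= s by rewrite (le_trans (F_ge0 c))// ltW.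
have [y [yT <- yE]] := tau_ltP s0 (lt_supF bT sb).
rewrite tm_F// F_mono//.
by apply: itv0_le bT => //; have [c0 _] := cT; lra.
Qed.

Let iwcb (c b : R) : itv0 T c -> itv0 T b -> mu.-integrable `]c, b] (EFin \o w).
Proof.
move=> cT bT; apply: integrableS (iw bT.2) => // x /=; rewrite !in_itv/= => /andP[cx ->].
by have [c0 _] := cT; rewrite (le_lt_trans c0 cx).
Qed.

(** Passing to the new time transports the length element. *)
Let changed_length (c b : R) : itv0 T c -> itv0 T b -> c <= b ->
  (\int[mu]_(s in `]F c, F b]) (m' s)%:E = \int[mu]_(t in `]c, b]) (m t)%:E)%E.
Proof.
move=> cT bT cb.
transitivity (\int[mu]_(s in `]F c, F b]) (m (tm s) `^ k)%:E)%E.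
  apply: eq_integral => s; rewrite inE/= in_itv/= => /andP[_ sb].
  by rewrite /changed_speed (lt_supF bT sb).
rewrite (@ge0_integral_time_change _ w F tm c b cb w0 (iwcb cT bT) (Fw cT bT) (tmF cT bT)
  (fun x => m x `^ k) mmk); last by move=> x; exact: powR_ge0.
by apply: eq_integral => t _; rewrite (powR_time_exp p1 p'1).
Qed.

Let new_null (N : set R) : measurable N -> mu N = 0%E ->
  {ae mu, forall s, 0 < s -> (s%:E < S0)%E -> ~ N (tm s)}.
Proof.
move=> mN N0; have [Tle0|Tgt0] := leP T 0%E.
  apply: aeW => s s0 sS; exfalso; have [x [[x0 xT] _ _]] := tau_ltP (ltW s0) sS.
  by have := lt_le_trans xT Tle0; rewrite lte_fin ltNge x0.
have [x [_ xT xex]] := itv0_exhaustion Tgt0.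
have zT : itv0 T 0 by split.
have : {ae mu, forall (s : R) n, 0 < s <= F (x n) -> ~ N (tm s)}.
  apply: ae_foralln => n; have xn0 : 0 <= x n by have [] := xT n.
  have := @time_change_null _ w F tm 0 (x n) xn0 w0 (iwcb zT (xT n)) (Fw zT (xT n))
     (tmF zT (xT n)) N mN N0.
  apply: negligibleS => s /= /not_implyP[sF /contrapT Ns].
  by rewrite F0.
apply: aeS => s h s0 sS; have [y [yT ys yE]] := tau_ltP (ltW s0) sS.
have [n yn] := xex _ yT.2.
by apply: (h n); rewrite s0 -ys F_mono.
Qed.

Lemma end_point_near (e : R) : (0 < T)%E -> (T = +oo%E -> cvg (u t @[t --> +oo])) ->
  0 < e -> exists2 t, itv0 T t & forall t', t <= t' -> (t'%:E < T)%E -> mdist (u t') uT < e.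
Proof.
move=> Tgt0 cvT e0; rewrite /uT; move: Tgt0 cvT.
case E : T => [r| |//]; last first.
  move=> _ /(_ erefl) cu.
  have /(_ _ (mdist_near _ e0)) [M [_ hM]] := cu.
  exists (Num.max M 0 + 1); first by split; rewrite ?ltry// addr_ge0// le_max lexx orbT.
  move=> t' Mt' _; rewrite metric_sym; apply: hM.
  by apply: lt_le_trans Mt'; rewrite ltr_pwDr// le_max lexx.
rewrite lte_fin => r0 _ /=.
have [d /= d0 hd] := curve_near um (ltW r0) e0.
exists (Num.max 0 (r - d / 2)).
  split; first by rewrite le_max lexx.
  by rewrite lte_fin gt_max r0 ltrBlDr ltrDl divr_gt0.
move=> t'; rewrite ge_max => /andP[t0 tr]; rewrite lte_fin => t'r.
by apply: hd => //=; rewrite ger0_norm; lra.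
Qed.

Lemma end_point_le t : (T = +oo%E -> cvg (u t @[t --> +oo])) -> itv0 T t ->
  (f uT <= f (u t))%E.
Proof.
move=> cvT tT; have [t0 tT'] := tT.
have Tgt0 : (0 < T)%E by apply: le_lt_trans tT'; rewrite lee_fin.
rewrite leNgt; apply/negP => ft.
have [b tb bT] : exists2 b : R, (f (u t) < b%:E)%E & (b%:E < f uT)%E.
  move: ft; rewrite -(fineK (fin_numf f_gtNy (fu t0))) => /ereal_between[b tb bT].
  by exists b.
have [V uV hV] := f_lsc bT.
have /metricType_numDomainType.nbhs_mdistP[e /= e0 he] := uV.
have [x xT hx] := end_point_near Tgt0 cvT e0.
have [x0 xT'] := xT.
have mT : ((Num.max x t)%:E < T)%E by rewrite EFin_max gt_max xT' tT'.
have : (b%:E < f (u (Num.max x t)))%E.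
  by apply: hV; apply: he => /=; rewrite metric_sym; apply: hx; rewrite // le_max lexx.
rewrite ltNge => /negP; apply; apply: le_trans (ltW tb).
by apply: nonincr => //; rewrite le_max lexx orbT.
Qed.

(** If [T = +oo] and the slope at the limit point were positive, it would
    stay above a positive constant along the end of [u], and [f] would decrease
    there at least at a fixed rate, which contradicts [end_point_le]. If [T] is
    finite it is not itself a time of positive slope. *)
Lemma end_point_slope : (S0 < +oo)%E -> local_slope f uT = 0%E.
Proof.
move=> Soo; have cvT h := ulim h Soo.
apply/eqP; rewrite eq_le local_slope_ge0 andbT leNgt; apply/negP => sl.
have [TE|TNoo] := eqVneq T +oo%E; last first.
  have Tfin : T \is a fin_num by rewrite ge0_fin_numE// lt_neqAle TNoo leey.
  have := sl; rewrite /uT -(fineK Tfin) /= slopeT ?fineK ?ltxx//.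
  by rewrite -lee_fin fineK.
have Tgt0 : (0 < T)%E by rewrite TE.
have zT : itv0 T 0 by split.
have fuT : (f uT < +oo)%E by apply: le_lt_trans (end_point_le cvT zT) (fu (lexx 0)).
have [c c0 cs] := ereal_between sl.
have p01 : 1 < p0 by have := p0_ge2; lra.
have /metricType_numDomainType.nbhs_mdistP[e /= e0 he] :=
  slope_lsc f_gtNy lambda_lt0 p01 f_convex f_lsc (ltW c0) fuT cs.
have [x [x0 _] hx] := end_point_near Tgt0 cvT e0.
pose d := (c `^ (p - 1)^-1) `^ p.
have d0 : 0 < d by rewrite !powR_gt0.
have pm1 : 0 < p - 1 by rewrite subr_gt0.
pose C := fine (f (u x)) - fine (f uT).
have C0 : 0 <= C.
  rewrite subr_ge0 fine_le ?fin_numf ?fu//.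
  by apply: end_point_le => //; split; rewrite // TE ltry.
pose y := x + C / d + 1.
have xy : x <= y by rewrite /y -addrA lerDl addr_ge0// divr_ge0// ltW.
have : (\int[mu]_(r in `]x, y]) (d%:E) <= \int[mu]_(r in `]x, y]) (m r `^ p)%:E)%E.
  apply: ae_ge0_le_integral => //.
  - by move=> r _; rewrite lee_fin ltW.
  - by move=> r _; rewrite lee_fin powR_ge0.
  - apply: measurable_funTS; apply/measurable_EFinP.
    exact: (measurableT_comp (measurable_powR p)).
  have [_ _ _ _ aem] := um; apply: aeS aem => t h /=; rewrite in_itv/= => /andP[xt ty].
  have [_ _ slE] := h (le_lt_trans x0 xt).
  have : (c%:E < local_slope f (u t))%E.
    apply: he => /=; rewrite metric_sym; apply: hx; first exact: ltW.
    by rewrite TE ltry.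
  rewrite slE lte_fin => cm.
  rewrite lee_fin /d ge0_ler_powR ?nnegrE ?powR_ge0//; first by have := p1; lra.
  have -> : m t = (m t `^ (p - 1)) `^ (p - 1)^-1.
    by rewrite -powRrM mulfV ?powRr1// gt_eqF.
  by rewrite ge0_ler_powR ?nnegrE ?invr_ge0 ?powR_ge0 ?(ltW c0) ?(ltW pm1) ?(ltW cm).
move=> /le_trans /(_ (energy_inequality f_gtNy um fu nonincr x0 xy)).
have muE : mu `]x, y]%classic = (y - x)%:E.
  rewrite lebesgue_measure_itv/= lte_fin; case: ltP => [_|ba]; first by rewrite EFinB.
  by congr EFin; lra.
rewrite integral_cst// [X in (_ * X)%E]muE -EFinM lee_fin.
have -> : d * (y - x) = C + d.
  by rewrite /y; field; rewrite gt_eqF.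
have : fine (f uT) <= fine (f (u y)).
  rewrite fine_le ?fin_numf ?fu//; first by lra.
  by apply: end_point_le => //; split; [lra|rewrite TE ltry].
rewrite /C; lra.
Qed.

Let Tgt0_S0 s : 0 <= s -> (s%:E < S0)%E -> (0 < T)%E.
Proof.
move=> s0 /(tau_ltP s0)[x [[x0 xT] _ _]]; apply: le_lt_trans xT.
by rewrite lee_fin.
Qed.

(** The new curve runs through the same length. When [S0] is finite this
    length is finite as well, since [m <= m^alpha + m^p] by [alpha <= 1 <= p]:
    the first term integrates to at most [S0], and the second one to at most the
    total drop of [f]. *)
Lemma changed_speed_integrable (K : R) : mu.-integrable `[0, K] (EFin \o m').
Proof.
have [K0|K0] := ltP K 0.
  by rewrite set_itv_ge -?leNgt ?bnd_simp -?ltNge//; exact: integrable_set0.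
apply/integrableP; split; first exact: mm'S.
under eq_integral do rewrite /= ger0_norm ?changed_speed_ge0//.
have [KS|SK] := ltP K%:E S0.
  have [x [xT <- _]] := tau_ltP K0 KS.
  have zT : itv0 T 0 by split => //; exact: Tgt0_S0 KS.
  rewrite -integral_itv_obnd_cbnd; last exact: mm'S.
  have x0 : 0 <= x by have [] := xT.
  rewrite -F0 changed_length// -ge0_fin_numE; last by apply: integral_ge0 => r _; rewrite lee_fin.
  by apply: integrable_fin_num => //; exact: (speed_integrable um).
have Soo : (S0 < +oo)%E by apply: le_lt_trans SK _; rewrite ltry.
have S0fin : S0 \is a fin_num by rewrite ge0_fin_numE.
have cvT h := ulim h Soo.
pose C : \bar R := maxe 0%E (fine S0 + (fine (f (u 0)) - fine (f uT)))%:E.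
apply: (@le_lt_trans _ _ (\int[mu]_(s in itv0 S0) (m' s)%:E)%E).
  rewrite integral_mkcond [leRHS]integral_mkcond.
  apply: ge0_le_integral_nomeas => s _; rewrite !patchE; case: ifPn => //.
    by rewrite lee_fin changed_speed_ge0.
  - rewrite inE/= in_itv/= => /andP[s0 sK]; case: ifPn => // sS.
    rewrite lee_fin /changed_speed; case: ifPn => // sS0.
    by move: sS; rewrite notin_setE => -[]; split.
  move=> _; case: ifPn => // _; rewrite lee_fin; exact: changed_speed_ge0.
apply: (@le_lt_trans _ _ C); last by rewrite /C gt_max ltry ltry.
apply: ge0_integral_itv0_le => //.
- exact: changed_speed_measurable.
- exact: changed_speed_ge0.
- by rewrite /C le_max lexx.
move=> s [s0 sS]; have [x [xT xs _]] := tau_ltP s0 sS.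
have zT : itv0 T 0 by split => //; exact: Tgt0_S0 sS.
have x0 : 0 <= x by have [] := xT.
rewrite -xs -{1}F0 changed_length// /C le_max; apply/orP; right.
have mp : measurable_fun setT (fun x => m x `^ p).
  exact: (measurableT_comp (measurable_powR p)).
apply: (@le_trans _ _ (\int[mu]_(r in `]0%R, x]) ((w r)%:E + (m r `^ p)%:E))%E).
  apply: ge0_le_integral => //.
  - by move=> r _; rewrite lee_fin.
  - exact: (speed_measurable_EFin um).
  - by apply: emeasurable_funD; apply: measurable_funTS; apply/measurable_EFinP.
  move=> r _; rewrite -EFinD lee_fin.
  have [->|mr] := eqVneq (m r) 0; first by rewrite addr_ge0 ?powR_ge0.
  have mr0 : 0 < m r by rewrite lt_neqAle eq_sym mr m0.
  have [m1|/ltW m1] := leP 1 (m r).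
    by apply: (le_trans (le1r_powR m1 (ltW p1))); rewrite lerDr powR_ge0.
  have a1 : a <= 1.
    by rewrite alpha_expE// lerBlDr lerDl ltW// time_exp_gt0.
  have m01 : 0 < m r <= 1 by rewrite mr0.
  by apply: (le_trans (ger1_powR m01 a1)); rewrite lerDl powR_ge0.
rewrite ge0_integralD//; first last.
- by apply: measurable_funTS; apply/measurable_EFinP.
- by move=> r _; rewrite lee_fin powR_ge0.
- by apply: measurable_funTS; apply/measurable_EFinP.
- by move=> r _; rewrite lee_fin powR_ge0.
rewrite EFinD; apply: leeD.
  rewrite -[leLHS]fineK; last by apply: integrable_fin_num => //; exact: iw xT.2.
  by rewrite lee_fin -[leLHS]/(F x) xs -lee_fin fineK// ltW.
apply: (le_trans (energy_inequality f_gtNy um fu nonincr (lexx 0) x0)).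
rewrite lee_fin lerD2l lerN2 fine_le ?fin_numf ?fu//; last exact: end_point_le.
by apply: le_lt_trans (end_point_le cvT xT) (fu x0).
Qed.

(** Past [S0] the curve stands at the end point, which is approached by
    points reached before [S0]. *)
Lemma changed_dist (s t : R) : 0 <= s -> s <= t ->
  mdist (v s) (v t) <= (\int[mu]_(r in `]s, t]) m' r)%R.
Proof.
move=> s0 st; have t0 : 0 <= t by exact: le_trans st.
have im'S (x y : R) : 0 <= x -> mu.-integrable `]x, y] (EFin \o m').
  move=> x0; apply: integrableS (changed_speed_integrable y) => //.
  by move=> z /=; rewrite !in_itv/= => /andP[xz ->]; rewrite (le_trans x0)// ltW.
have base x y : itv0 T x -> itv0 T y -> x <= y ->
    mdist (v (F x)) (v (F y)) <= (\int[mu]_(r in `](F x), (F y)]) m' r)%R.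
  move=> xT yT xy; rewrite !v_F// /Rintegral changed_length//.
  by apply: umd => //; have [] := xT.
have [SS|sS] := leP S0 s%:E.
  rewrite !v_geT//; last by apply: le_trans SS _; rewrite lee_fin.
  by rewrite mdistxx; apply: Rintegral_ge0 => r _; exact: changed_speed_ge0.
have [x [xT xs _]] := tau_ltP s0 sS; have [x0 xT'] := xT.
have [St|tS] := leP S0 t%:E; last first.
  have [y [yT yt _]] := tau_ltP t0 tS.
  by rewrite -xs -yt; apply: base => //; rewrite -F_mono// xs yt.
have Soo : (S0 < +oo)%E by apply: le_lt_trans St _; rewrite ltry.
apply/ler_addgt0Pr => e e0.
have [z zT hz] := end_point_near (Tgt0_S0 s0 sS) (fun h => ulim h Soo) e0.
have yT : itv0 T (Num.max x z).
  by split; [rewrite le_max x0|rewrite EFin_max gt_max xT' zT.2].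
have xy : x <= Num.max x z by rewrite le_max lexx.
have Fyt : F (Num.max x z) <= t.
  by rewrite -lee_fin; apply: le_trans St; rewrite ltW// F_lt.
rewrite (v_geT St); apply: le_trans (metric_triangle _ (v (F (Num.max x z))) _) _.
apply: lerD; last first.
  by rewrite v_F// ltW// hz ?yT.2// le_max lexx orbT.
rewrite -xs; apply: le_trans (base _ _ xT yT xy) _.
rewrite /Rintegral fine_le//.
- by apply: integrable_fin_num => //; exact: im'S.
- by apply: integrable_fin_num => //; exact: im'S.
apply: ge0_subset_integral => //.
- exact: mm'S.
- by move=> r _; rewrite lee_fin changed_speed_ge0.
- by move=> r /=; rewrite !in_itv/= => /andP[-> ry]; rewrite (le_trans ry).
Qed.

Lemma changed_nonincr s t : 0 <= s -> s <= t -> (f (v t) <= f (v s))%E.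
Proof.
move=> s0 st; have t0 : 0 <= t by exact: le_trans st.
have [SS|sS] := leP S0 s%:E.
  by rewrite !v_geT//; apply: le_trans SS _; rewrite lee_fin.
have [x [xT xs _]] := tau_ltP s0 sS; have [x0 xT'] := xT.
have [St|tS] := leP S0 t%:E.
  rewrite (v_geT St) -xs v_F//; apply: end_point_le => // h; apply: ulim => //.
  by apply: le_lt_trans St _; rewrite ltry.
have [y [yT yt _]] := tau_ltP t0 tS.
by rewrite -xs -yt !v_F//; apply: nonincr => //; rewrite -F_mono// xs yt.
Qed.

Lemma changed_curve0 : v 0 = u 0.
Proof.
have [Tgt0|Tle0] := ltP 0%E T.
  have zT : itv0 T 0 by split.
  by rewrite -[in LHS]F0 v_F.
have TE : T = 0%E by apply/eqP; rewrite eq_le Tle0.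
have [S0gt0|S0le0] := ltP 0%E S0; last by rewrite v_geT// /uT TE.
by have := Tgt0_S0 (lexx 0) S0gt0; rewrite TE ltxx.
Qed.

(** The chain rule for [u o tau] at a time [F x], where [x] is a time at
    which all the identities hold for [u]. *)
Let changed_at (x : R) : 0 < x -> (x%:E < T)%E ->
  mdist (u x) (u s) / `|x - s| @[s --> x^'] --> m x ->
  is_derive x (1 : R) (fine \o f \o u : R -> R) (- (m x `^ p)) ->
  local_slope f (u x) = (m x `^ (p - 1))%:E ->
  is_derive x (1 : R) F (w x) -> 0 < m x ->
  [/\ mdist (v (F x)) (v s) / `|F x - s| @[s --> (F x)^'] --> m' (F x),
      is_derive (F x) (1 : R) (fine \o f \o v : R -> R) (- (m' (F x) `^ p')) &
      local_slope f (v (F x)) = (m' (F x) `^ (p' - 1))%:E].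
Proof.
move=> x0 xT qt dphi slE dF mx.
have xT' : itv0 T x by split=> //; exact: ltW.
have m'E : m' (F x) = m x `^ k by rewrite /changed_speed F_lt// tm_F.
have wx : 0 < w x by rewrite powR_gt0.
have [z xz zT] := ereal_between xT.
have nearx : \forall y \near x, y \in `]0, z[ by apply: near_in_itvoo; rewrite in_itv/= x0.
have zitv y : y \in `]0, z[ -> itv0 T y.
  rewrite in_itv/= => /andP[y0 yz]; split; first exact: ltW.
  by apply: lt_trans zT; rewrite lte_fin.
have cF : {in `]0, z[, continuous F}.
  have oz : open (`]0, z[%classic : set R) by exact: interval_open.
  have /(continuous_subspaceW (@subset_itv_oo_cc _ _ 0 z)) : {within `[0, z], continuous F}.
    by apply: (@primitive_continuous _ _ T) => *; prim || exact: zT.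
  rewrite continuous_open_subspace// => h y yz; apply: h.
  by rewrite inE /=.
have dtm : is_derive (F x) (1 : R) tm (w x)^-1.
  apply: is_derive_inverse; rewrite ?gt_eqF//.
    by apply: filterS nearx => y /zitv; exact: tm_F.
  by apply: filterS nearx => y; exact: cF.
have nearF : \forall s \near F x, exists y, [/\ itv0 T y, F y = s & tm s = y].
  have h1 : \forall s \near F x, 0 < s.
    apply: lt_nbhsr; rewrite -F0 (@primitive_lt _ _ T) => *; prim || by [].
  have [b xb bS] := ereal_between (F_lt xT').
  have h2 : \forall s \near F x, s < b by exact: lt_nbhsl.
  apply: filterS2 h1 h2 => s s0 sb.
  have sS : (s%:E < S0)%E by apply: lt_trans bS; rewrite lte_fin.
  have [y [yT ys yE]] := tau_ltP (ltW s0) sS.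
  by exists y; rewrite /tm yE.
split.
- rewrite m'E.
  have ctm : tm s @[s --> (F x)^'] --> x^'.
    have ct : {for F x, continuous tm}.
      apply: differentiable_continuous; apply/derivable1_diffP.
      by have [] := dtm.
    have ct' : tm s @[s --> F x] --> x by rewrite -[X in _ --> X](tm_F xT'); exact: ct.
    move=> A nA; have h : \forall s \near F x, tm s != x -> A (tm s) := ct' _ nA.
    suff : \forall s \near (F x)^', A (tm s) by [].
    have h' : \forall s \near (F x)^', tm s != x -> A (tm s) by exact: cvg_within h.
    have h'' : \forall s \near (F x)^', exists y, [/\ itv0 T y, F y = s & tm s = y].
      exact: cvg_within nearF.
    near=> s.
    have sFx : s != F x by near: s; exact: nbhs_dnbhs_neq.
    have hs : tm s != x -> A (tm s) by near: s; exact: h'.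
    have [y [yT ys yE]] : exists y, [/\ itv0 T y, F y = s & tm s = y] by near: s; exact: h''.
    apply: hs; rewrite yE; apply: contraNneq sFx => <-.
    by rewrite ys.
  have c1 : mdist (u x) (u (tm s)) / `|x - tm s| @[s --> (F x)^'] --> m x.
    exact: cvg_comp ctm qt.
  have c2 : `|(tm s - tm (F x)) / (s - F x)| @[s --> (F x)^'] --> `|(w x)^-1|.
    by apply: cvg_norm; exact: is_derive_cvg_quotient.
  have -> : m x `^ k = m x * `|(w x)^-1|.
    rewrite ger0_norm ?invr_ge0 ?(ltW wx)//.
    by apply: (canRL (mulfK (lt0r_neq0 wx))); exact: powR_time_exp.
  apply: cvg_trans (cvgM c1 c2); apply: near_eq_cvg; near=> s.
  have sFx : s != F x by near: s; exact: nbhs_dnbhs_neq.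
  have [y [yT ys yE]] : exists y, [/\ itv0 T y, F y = s & tm s = y].
    by near: s; exact: cvg_within nearF.
  rewrite /= yE tm_F// -ys !v_F// normrM normfV (distrC x y) ys (distrC (F x)).
  rewrite mulrA divfK// normr_eq0 subr_eq0.
  by apply: contraNneq sFx => <-; rewrite ys.
- have -> : - (m' (F x) `^ p') = - (m x `^ p) * (w x)^-1.
    rewrite m'E -powRrM time_expMp'// mulNr; congr (- _).
    by rewrite powRB//; apply/implyP => _; rewrite gt_eqF.
  apply: (@near_eq_is_derive _ _ _ ((fine \o f \o u) \o tm)).
    apply: filterS nearF => s [y [yT ys yE]] /=.
    by rewrite yE -ys v_F.
  apply: is_derive1_comp dtm.
  by rewrite tm_F.
- by rewrite v_F// slE m'E -powRrM time_expM.
Unshelve. all: by end_near. Qed.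

(** The time change turns the pointwise identities satisfied by [u] into those
    for the exponent [p']; past [primitive_sup w T] the new curve rests at a
    point of zero slope. *)
Lemma changed_curve_maximal_speed : maximal_speed f p' v m'.
Proof.
split.
- exact: changed_speed_measurable.
- exact: changed_speed_ge0.
- exact: changed_speed_integrable.
- exact: changed_dist.
have dw := weight_derive f_gtNy f_lsc lambda_lt0 p0_ge2 f_convex p1 p_le p'1 um fu nonincr.
have mgt0 := speed_gt0 f_gtNy f_lsc lambda_lt0 p0_ge2 f_convex p1 p_le um fu nonincr.
have [_ _ _ _ aem] := um.
have good := aeS2 (fun x hx hy => conj hx hy) aem (aeS2 (fun x hx hy => conj hx hy) dw mgt0).
have [N [mN N0 hN]] := good.
apply: aeS2 (new_null mN N0) (ae_neq (fine S0)) => s hs sS s0.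
have [Ss|sS0] := leP S0 s%:E.
  have Soo : (S0 < +oo)%E by apply: le_lt_trans Ss _; rewrite ltry.
  have Sfin : S0 \is a fin_num by rewrite ge0_fin_numE.
  have {}Ss : fine S0 < s.
    by rewrite lt_neqAle eq_sym sS/= -lee_fin fineK.
  have nearS : \forall r \near s, v r = uT.
    have : \forall r \near s, fine S0 < r by exact: lt_nbhsr.
    apply: filterS => r Sr; apply: v_geT.
    by rewrite -(fineK Sfin) lee_fin ltW.
  have vs : v s = uT by exact: nbhs_singleton nearS.
  have m's : m' s = 0.
    by rewrite /changed_speed -(fineK Sfin) lte_fin ltNge (ltW Ss).
  rewrite m's; split.
  - have : (fun _ : R => 0 : R) r @[r --> s^'] --> (0 : R) by exact: cvg_cst.
    apply: cvg_trans; apply: near_eq_cvg; apply: cvg_within.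
    by apply: filterS nearS => r ->; rewrite vs mdistxx mul0r.
  - rewrite powR0 ?gt_eqF ?(lt_trans _ p'1)// oppr0.
    apply: (@near_eq_is_derive _ _ _ (cst (fine (f uT)))).
      by apply: filterS nearS => r /= ->.
  - by rewrite vs end_point_slope// powR0// subr_eq0 gt_eqF.
have [x [xT xs xE]] := tau_ltP (ltW s0) sS0; have [x0 xT'] := xT.
have {}x0 : 0 < x.
  rewrite lt_neqAle x0 andbT; apply/eqP => x00; move: s0.
  by rewrite -xs -x00 F0 ltxx.
have := hs s0 sS0; rewrite /tm xE /= => Nx.
have /contrapT[ax [dx mx]] : ~ ~ ((0 < x -> [/\ mdist (u x) (u s) / `|x - s| @[s --> x^'] --> m x,
    is_derive x (1 : R) (fine \o f \o u : R -> R) (- (m x `^ p)) &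
    local_slope f (u x) = (m x `^ (p - 1))%:E]) /\
    ((0 < x -> (x%:E < T)%E -> is_derive x (1 : R) F (w x)) /\
     (0 < x -> (x%:E < T)%E -> 0 < m x))).
  by move=> h; apply: Nx; apply: hN.
have [qt dphi slE] := ax x0.
by rewrite -xs; apply: changed_at => //; [exact: dx|exact: mx].
Qed.

Hypothesis p'_le : p' <= p0.

Let vm : maximal_speed f p' v m' := changed_curve_maximal_speed.

Let fv s : 0 <= s -> (f (v s) < +oo)%E.
Proof.
move=> s0; apply: le_lt_trans (changed_nonincr (lexx 0) s0) _.
by rewrite changed_curve0 fu.
Qed.

Lemma Tstar_changed_curve : Tstar f +oo%E v = S0.
Proof.
apply: eq_ereal_lower => [| |s s0]; [by rewrite /Tstar le_max lexx|exact: S0_ge0|].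
rewrite -(slope_gt0_Tstar f_gtNy p'1 vm fv changed_nonincr lambda_lt0 p0_ge2 p'_le f_convex f_lsc)//.
have [Ss|sS] := leP S0 s%:E.
  by rewrite v_geT// end_point_slope ?ltxx//; apply: le_lt_trans Ss _; rewrite ltry.
have [x [xT <- _]] := tau_ltP s0 sS; have [x0 xT'] := xT.
by rewrite v_F// slopeT.
Qed.

Lemma time_mapE s : time_map f p p' u s = tau s.
Proof.
rewrite /time_map /primitive_inv; congr (maxe _ (ereal_sup _)); apply/seteqP.
have intE t : itv0 T t ->
    (\int[mu]_(r in `]0%R, t]) (metric_derivative u r `^ a)%:E = (F t)%:E)%E.
  move=> tT; rewrite (metric_derivative_integral p' um)//; last first.
    by move=> r /=; rewrite in_itv/= => /andP[/ltW].
  by rewrite /primitive /Rintegral fineK//; apply: integrable_fin_num => //; exact: iw tT.2.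
by split => _ [t [tT ts] <-]; exists t => //; split => //; move: ts;
  rewrite intE// lee_fin.
Qed.

(** Seen from the new curve, the time elapsed along the old one is again the
    integral of a power of the speed, with the roles of [p] and [p']
    exchanged. *)
Lemma old_time_integral s : 0 <= s -> (s%:E < S0)%E ->
  (\int[mu]_(r in `]0%R, s]) (metric_derivative v r `^ alpha_exp p' p)%:E)%E = (tm s)%:E.
Proof.
move=> s0 sS; rewrite (metric_derivative_integral p vm)//; last first.
  by move=> r /=; rewrite in_itv/= => /andP[/ltW].
have [x [xT xs xE]] := tau_ltP s0 sS; have [x0 xT'] := xT.
have zT : itv0 T 0 by split => //; exact: Tgt0_S0 sS.
pose b := k * alpha_exp p' p.
have kb : b = - a.
  rewrite /b (alpha_expE p'1 p1) (alpha_expE p1 p'1) /time_exp.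
  by field; rewrite !subr_eq0 !gt_eqF.
have mmb : measurable_fun setT (fun x => m x `^ b).
  exact: (measurableT_comp (measurable_powR b)).
transitivity (\int[mu]_(r in `]F 0%R, F x]) (m (tm r) `^ b)%:E)%E.
  rewrite xs F0; apply: eq_integral => r; rewrite inE/= in_itv/= => /andP[_ rs].
  have rS : (r%:E < S0)%E by apply: le_lt_trans sS; rewrite lee_fin.
  by rewrite /changed_speed rS -powRrM.
rewrite (@ge0_integral_time_change _ w F tm 0 x x0 w0 (iwcb zT xT) (Fw zT xT) (tmF zT xT)
  (fun x => m x `^ b) mmb); last by move=> r; exact: powR_ge0.
transitivity (\int[mu]_(r in `]0%R, x]) (cst 1%E r))%E; last first.
  rewrite integral_cst// mul1e [LHS](_ : _ = mu `]0, x]%classic)//.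
  rewrite lebesgue_measure_itv/= lte_fin /tm xE /=; case: ltP => [_|x0'].
    by rewrite -EFinB subr0.
  by congr EFin; lra.
apply: ge0_ae_eq_integral => //.
- apply: measurable_funTS; apply/measurable_EFinP; apply: measurable_funM => //.
- by move=> r _; rewrite lee_fin mulr_ge0 ?powR_ge0.
have mgt0 := speed_gt0 f_gtNy f_lsc lambda_lt0 p0_ge2 f_convex p1 p_le um fu nonincr.
apply: aeS mgt0 => r hr; rewrite /= in_itv/= => /andP[r0 rx].
have mr : 0 < m r by apply: hr => //; apply: le_lt_trans xT'; rewrite lee_fin.
by rewrite kb powRN mulVf// gt_eqF// powR_gt0.
Qed.

Let inv_time_mapE r : time_map f p' p v r =
  maxe 0%E (ereal_sup [set s%:E | s in [set s | itv0 S0 s /\ tm s <= r]]).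
Proof.
rewrite /time_map Tstar_changed_curve; congr (maxe _ (ereal_sup _)); apply/seteqP.
by split => _ [t [[t0 tT] ts] <-]; exists t => //; split => //; move: ts;
  rewrite old_time_integral// lee_fin.
Qed.

Lemma time_map_inverse_lt r : itv0 T r -> time_map f p' p v r = (F r)%:E.
Proof.
move=> rT; rewrite inv_time_mapE; apply/eqP; rewrite eq_le; apply/andP; split.
  rewrite ge_max lee_fin F_ge0/=; apply: ge_ereal_sup => _ [s [[s0 sS] +] <-].
  have [x [xT <- _]] := tau_ltP s0 sS.
  by rewrite tm_F// lee_fin F_mono.
rewrite le_max; apply/orP; right; apply: ereal_sup_ubound; exists (F r) => //.
by split; [split; [exact: F_ge0|exact: F_lt]|rewrite tm_F].
Qed.

Lemma time_map_inverse_ge r : (T <= r%:E)%E -> time_map f p' p v r = S0.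
Proof.
move=> Tr; rewrite inv_time_mapE; apply/eqP; rewrite eq_le; apply/andP; split.
  rewrite ge_max S0_ge0/=; apply: ge_ereal_sup => _ [s [[s0 sS] _] <-].
  exact: ltW.
rewrite /primitive_sup ge_max le_max lexx/=; apply: ge_ereal_sup => _ [x xT <-].
rewrite le_max; apply/orP; right; apply: ereal_sup_ubound; exists (F x) => //.
split; first by split; [exact: F_ge0|exact: F_lt].
by rewrite tm_F// -lee_fin; apply: le_trans Tr; exact: ltW xT.2.
Qed.

Let cvg_end : S0 = +oo%E -> (T < +oo)%E -> v s @[s --> +oo] --> uT.
Proof.
move=> SE Too; have Tgt0 : (0 < T)%E by apply: (@Tgt0_S0 0) => //; rewrite SE ltry.
move=> A /metricType_numDomainType.nbhs_mdistP[e /= e0 he].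
have cvT : T = +oo%E -> cvg (u t @[t --> +oo]) by move=> h; move: Too; rewrite h.
have [t tT ht] := end_point_near Tgt0 cvT e0.
exists (F t); split; first by rewrite num_real.
move=> s Fts; apply: he => /=; rewrite metric_sym.
have s0 : 0 <= s by apply: le_trans (F_ge0 t) _; exact: ltW.
have sS : (s%:E < S0)%E by rewrite SE ltry.
have [x [xT xs _]] := tau_ltP s0 sS.
rewrite -xs v_F//; apply: ht; last by case: xT.
by rewrite -F_mono// xs ltW.
Qed.

Lemma inverse_transformation r : 0 <= r -> u r = curve_at v (time_map f p' p v r).
Proof.
move=> r0; have [Tr|rT] := leP T r%:E; last first.
  by have rT' : itv0 T r by []; rewrite time_map_inverse_lt//= v_F.
have Too : (T < +oo)%E by apply: le_lt_trans Tr _; rewrite ltry.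
have Tfin : T \is a fin_num by rewrite ge0_fin_numE.
have uTr : u r = uT.
  have T0' : 0 <= fine T by rewrite -lee_fin fineK.
  rewrite /uT -(fineK Tfin) /=.
  apply: (stationary_after f_gtNy p1 um fu nonincr lambda_lt0 p0_ge2 p_le f_convex T0').
    apply/eqP; rewrite eq_le local_slope_ge0 andbT leNgt slopeT// fineK//.
    by rewrite ltxx.
  by rewrite -lee_fin fineK.
rewrite time_map_inverse_ge// uTr.
have := S0_ge0; case SE : S0 => [s| |//] _ /=.
  by rewrite v_geT// SE.
by apply/esym/cvg_lim; [exact: metric_hausdorff|exact: cvg_end].
Qed.

(** The total old time [T] is the integral [Sstar] of the new curve: when it is
    infinite, so is that integral, and when it is finite the new curve converges
    to the point that [u] reaches at time [T]. *)
Lemma changed_admissible :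
  [\/ Sstar f +oo%E p' p v = +oo%E,
      (Sstar f +oo%E p' p v < +oo)%E /\ (Tstar f +oo%E v < +oo)%E |
      [/\ (Sstar f +oo%E p' p v < +oo)%E, Tstar f +oo%E v = +oo%E &
          cvg (v t @[t --> +oo])]].
Proof.
have [S'oo|S'oo] := eqVneq (Sstar f +oo%E p' p v) +oo%E; first exact: Or31.
have S'lt : (Sstar f +oo%E p' p v < +oo)%E by rewrite lt_neqAle S'oo leey.
rewrite Tstar_changed_curve.
have [Soo|Soo] := eqVneq S0 +oo%E; last first.
  by apply: Or32; split => //; rewrite lt_neqAle Soo leey.
apply: Or33; split => //; apply/cvg_ex; exists uT; apply: cvg_end => //.
rewrite lt_neqAle leey andbT; apply/eqP => TE.
move: S'lt; rewrite ltNge leye_eq => /negP; apply; apply/eqP.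
apply/eqyP => x x0; have xT : itv0 T x by split; [exact: ltW|rewrite TE ltry].
rewrite -{1}(tm_F xT) -old_time_integral ?F_ge0 ?F_lt//.
rewrite /Sstar Tstar_changed_curve integral_mkcond [leRHS]integral_mkcond.
apply: ge0_le_integral_nomeas => r _; rewrite !patchE.
  by case: ifP => // _; rewrite lee_fin powR_ge0.
case: ifPn => [|_]; last by case: ifP => // _; rewrite lee_fin powR_ge0.
rewrite inE/= in_itv/= => /andP[r0 rx].
rewrite mem_set//; split; first exact: ltW.
by rewrite Soo ltry.
Qed.

End time_changed_curve.

(** * Existence of the transformations *)

Theorem theorem1p4 (R : realType) (S : completeMetricType R)
    (f : S -> \bar R) (u0 : S) (p0 lambda : R)
    (f_gtNy : forall v, (-oo < f v)%E)
    (f_proper : proper_functional f)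
    (f_lsc : lower_semicontinuous f)
    (u0_dom : finite_domain f u0)
    (lambda_lt0 : lambda < 0)
    (p0_ge2 : 2 <= p0)
    (f_convex : pl_convex f p0 lambda) :
  exists tmap : R -> R -> (R -> S) -> R -> \bar R,
  forall (p p' : R) (u : R -> S), admissible f p0 u0 p p' u ->
    let u' : R -> S := fun s => curve_at u (tmap p p' u s) in
    [/\ [/\ (forall s : R, 0 <= s -> (0 <= tmap p p' u s <= Tstar f +oo%E u)%E),
            (forall s t : R, 0 <= s -> s <= t -> (tmap p p' u s <= tmap p p' u t)%E),
            {within `[0, +oo[, continuous (tmap p p' u)} &
            (forall s : R, 0 <= s -> tmap p p' u s = +oo%E ->
               cvg (u t @[t --> +oo]))],
        CMS f p' +oo%E u0 u',
        (forall v, CMS f p +oo%E u0 v -> (forall t : R, 0 <= t -> v t = u t) ->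
           forall s : R, 0 <= s -> tmap p p' u s = tmap p p' v s) &
        admissible f p0 u0 p' p u' /\
        (forall s : R, 0 <= s -> u s = curve_at u' (tmap p' p u' s))].
Proof.
exists (time_map f) => p p' u [p_bd p'_bd cms cases].
have /andP[p1 p_le] := p_bd; have /andP[p'1 p'_le] := p'_bd.
have [m um] := CMS_maximal_speed f_gtNy lambda_lt0 p0_ge2 f_convex p1 u0_dom cms.
have fu t : 0 <= t -> (f (u t) < +oo)%E by exact: CMS_fin u0_dom cms.
have [_ uu0 ni _] := cms.
have nonincr s t : 0 <= s -> s <= t -> (f (u t) <= f (u s))%E.
  by move=> s0 st; apply: ni => //; split; rewrite ?ltry// (le_trans s0).
have T0 := Tstar_ge0 f u.
have mw := weight_measurable p' um.
have w0 := weight_ge0 p p' m.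
have iw := weight_integrable f_gtNy f_lsc lambda_lt0 p0_ge2 f_convex p1 p_le p'1 um fu nonincr.
have wpos := weight_integral_gt0 f_gtNy f_lsc lambda_lt0 p0_ge2 f_convex p1 p_le p'1 um fu nonincr.
have tauE := time_mapE f_gtNy f_lsc lambda_lt0 p0_ge2 f_convex p1 p_le p'1 um fu nonincr.
(* a bounded primitive makes Sstar finite, so that an infinite Tstar leaves
   only the third case *)
have ulim : Tstar f +oo%E u = +oo%E ->
    (primitive_sup (fun r => (m r `^ alpha_exp p p')%R) (Tstar f +oo%E u) < +oo)%E ->
    cvg (u t @[t --> +oo]).
  move=> TE Soo; case: cases => [SE|[_]|[_ _ //]]; last by rewrite TE.
  move: Soo; rewrite ltNge => /negP[]; apply: le_trans (_ : (Sstar f +oo%E p p' u <= _)%E).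
    by rewrite SE.
  have mT : measurable (itv0 (Tstar f +oo%E u)).
    apply: is_interval_measurable => x y [x0 _] [_ yT] z /andP[xz zy].
    by split; [exact: le_trans xz|apply: le_lt_trans yT; rewrite lee_fin].
  rewrite /Sstar -/(itv0 _) (metric_derivative_integral p' um mT); last by move=> r [].
  apply: ge0_integral_itv0_le => //; first by rewrite /primitive_sup le_max lexx.
  move=> x xT; rewrite /primitive_sup le_max; apply/orP; right.
  apply: ereal_sup_ubound; exists x => //.
  rewrite /primitive /Rintegral fineK//.
  by apply: integrable_fin_num => //; exact: iw xT.2.
have cs := changed_curve_maximal_speed f_gtNy f_lsc lambda_lt0 p0_ge2 f_convex p1 p_le p'1
  um fu nonincr ulim.
have inv := inverse_transformation f_gtNy f_lsc lambda_lt0 p0_ge2 f_convex p1 p_le p'1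
  um fu nonincr ulim p'_le.
have adm := changed_admissible f_gtNy f_lsc lambda_lt0 p0_ge2 f_convex p1 p_le p'1
  um fu nonincr ulim p'_le.
have c0 := changed_curve0 f_gtNy f_lsc lambda_lt0 p0_ge2 f_convex p1 p_le p'1 um fu nonincr.
have cni := changed_nonincr f_gtNy f_lsc lambda_lt0 p0_ge2 f_convex p1 p_le p'1
  um fu nonincr ulim.
have vE : (fun s => curve_at u (time_map f p p' u s)) = (fun s => curve_at u
    (primitive_inv (fun r => m r `^ alpha_exp p p') (Tstar f +oo%E u) s)).
  by apply/funext => s; rewrite tauE.
rewrite /= vE.
have cms' := maximal_speed_CMS p'1 cs (fun s t => @cni s t) (etrans c0 uu0).
split.
- split.
  + move=> s s0; rewrite tauE; apply/andP; split.
      exact: primitive_inv_ge0.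
    exact: primitive_inv_leT.
  + move=> s t s0 st; rewrite !tauE.
    exact: primitive_inv_nd.
  + rewrite (_ : time_map f p p' u = primitive_inv (fun r => m r `^ alpha_exp p p')
      (Tstar f +oo%E u)); last exact/funext.
    exact: primitive_inv_continuous.
  + move=> s s0; rewrite tauE => tE; apply: ulim.
      by apply/eqP; rewrite -leye_eq -{1}tE; exact: primitive_inv_leT.
    rewrite ltNge leye_eq; apply/negP => /eqP SE.
    have sS : (s%:E < primitive_sup (fun r => (m r `^ alpha_exp p p')%R) (Tstar f +oo%E u))%E.
      by rewrite SE ltry.
    have [x [_ _]] := primitive_inv_ltP mw iw wpos s0 sS.
    by rewrite tE.
- exact: cms'.
- move=> v _ vu s _.
  exact: time_map_ext.
- split; last exact: inv.
  by split.
Qed.
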